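(* For every positive integer $n$, the composition $\phi\circ\psi^{-1}\circ M$ is a bijection from $\mathcal{SP}_n$ (the set of $2$-Schröder paths of semilength $n$ having neither peaks $NE$ nor valleys $EN$ and ending with a diagonal step) to $\mathcal{IS}_n(102)$ (the set of $102$-avoiding inversion sequences of length $n$). Moreover, $\mathrm{block}(P)=\mathrm{rank}\big((\phi\circ\psi^{-1}\circ M)(P)\big)+1$ for every $P\in\mathcal{SP}_n$.
   Context: **Inversion sequences.** An inversion sequence of length $n$ is an integer sequence $e=(e_1,\dots,e_n)$ with $0\le e_j\le j-1$ for all $j$. It avoids $102$ if there are no $i<j<k$ with $e_j<e_i<e_k$; $\mathcal{IS}_n(102)$ is the set of those of length $n$ avoiding $102$. $\max(e)$ is the largest entry, and $\mathrm{fdes}(e)$ is the position $p$ of the first descent: $e_1\le\cdots\le e_p>e_{p+1}$, with the convention $e_{n+1}=-1$. For $e\in\mathcal{IS}_n(102)$ one has $e_p=\max(e)$ for $p=\mathrm{fdes}(e)$, and $\mathrm{rank}(e):=\mathrm{fdes}(e)-\max(e)-1\ge 0$. **$2$-Schröder paths.** A $2$-Schröder path of semilength $n$ is a lattice path from $(0,0)$ to $(n,2n)$ that does not go below the line $y=2x$, with steps $N=(0,1)$, $E=(1,0)$, $H=(1,1)$. $\mathcal{SP}_n$ is the set of those with no consecutive $NE$ (peak), no consecutive $EN$ (valley), and ending with an $H$ step. A return is a diagonal step that touches (i.e. ends on) the line $y=2x$; $\mathrm{block}(P)$ is the number of returns of $P$. **UVD paths.** A UVD path of semilength $n$ is a lattice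 path from $(0,0)$ to $(2n,0)$ staying weakly above the $x$-axis, with steps $u=(1,1)$, $d=(1,-1)$, $v=(0,-2)$, with no consecutive $uv$ or $vu$, ending with a $d$ step. $\mathcal{UVD}_n$ is the set of these. A return is a $d$ step ending on the $x$-axis; $\mathrm{vox}(S)$ is the number of valleys $du$ of $S$ on the $x$-axis (so a nonempty $S$ has $\mathrm{vox}(S)+1$ returns). $M:\mathcal{SP}_n\to\mathcal{UVD}_n$ is the map replacing each $N$ by $u$, each $E$ by $v$, and each $H$ by $d$ (induced by the linear map with matrix $\begin{pmatrix}0&1\\-2&1\end{pmatrix}$). **Labeled $F$-paths.** Let $F=\{(a,1):a\ge0\}\cup\{(a,b):a\ge1,b\le0\}$ ($a,b$ integers). An $F$-path is a lattice path $(x_0,y_0)=(0,0),(x_1,y_1),\dots,(x_\ell,y_\ell)$ in $\mathbb Z^2$ not going below the line $y=x$ and all of whose steps $(x_j-x_{j-1},y_j-y_{j-1})$ lie in $F$. A labeled $F$-path is an $F$-path in which each step $(a,1)$ has label $(a;1)$, and each step $(a,b)$ with $b\le0$ has a label $(a;b_1,\dots,b_k)$ with $k\ge1$, nonpositive integers $b_i$, $b_1+\cdots+b_k=b$. A step with label $(a;b_1,\dots,b_k)$ has semilength $k$ (a step labeled $(a;1)$ has semilength $1$); the semilength of the path is the sum of semilengths of its steps. $\mathcal{LF}_n$ is the set of labeled $F$-paths of semilength $n$; $\mathrm{height}(Q)=y_\ell-x_\ell$. **The map $\phi:\mathcal{LF}_n\to\mathcal{IS}_{n+1}(102)$.** The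 path with no steps is sent to $(0)$. For $Q$ with $\ell\ge1$ steps, let $\hat Q$ be $Q$ with its last step removed, $\hat e=\phi(\hat Q)$, $\hat p=\mathrm{fdes}(\hat e)$, and, if the last step is $(a,b)$, $m=\max(\hat e)+a$. (1) If the last label is $(a;1)$, $\phi(Q)$ is obtained from $\hat e$ by inserting one entry $m$ immediately after $\hat e_{\hat p}$. (2) If the last label is $(a;b_1,\dots,b_k)$ with $a\ge1$ and all $b_i\le0$, $\phi(Q)$ is obtained from $\hat e$ by inserting $k$ entries equal to $m$, immediately after the entries $\hat e_{j_1},\dots,\hat e_{j_k}$, where $j_1=\hat p+b_1+\cdots+b_k-1$ and $j_i=\hat p+b_i+\cdots+b_k$ for $2\le i\le k$ (coinciding $j_i$'s mean multiple insertions at the same place). **The map $\psi:\mathcal{LF}_n\to\mathcal{UVD}_{n+1}$** (a bijection). The path with no steps is sent to $ud$. For $Q$ with $\ell\ge1$ steps, let $\hat Q$ be as before, $\hat S=\psi(\hat Q)=\hat s_1\hat s_2\cdots\hat s_N$ (word of steps), $\hat h=\mathrm{height}(\hat Q)=\mathrm{vox}(\hat S)$, so $\hat S$ has $\hat h+1$ returns. (1) If the last label is $(a;1)$, let $p$ be the index of the $(\hat h+1-a)$-th return in $\hat S$ ($p=0$ if $\hat h+1-a=0$), $\alpha=\hat s_1\cdots\hat s_p$, $\beta=\hat s_{p+1}\cdots\hat s_N$; $\psi(Q)=\alpha\,u\,\beta\,d$. (2) If the last label is $(a;b_1,\dots,b_k)$ with $a\ge1$, all $b_i\le0$, let $j_i$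 be the index of the $(\hat h+1+b_{i+1}+\cdots+b_k-a)$-th return of $\hat S$ for $i=0,\dots,k$, and let $p$ be the index with $\hat s_p\ne v$, $\hat s_{p+1}=\cdots=\hat s_{j_0-1}=v$, $\hat s_{j_0}=d$. Put $\alpha=\hat s_1\cdots\hat s_p$, $\beta=\hat s_{p+1}\cdots\hat s_{j_0}$, $\sigma_i=\hat s_{j_{i-1}+1}\cdots\hat s_{j_i}$ ($1\le i\le k$, possibly empty), $\tau=\hat s_{j_k+1}\cdots\hat s_N$; $\psi(Q)=\alpha\;u\sigma_1u\;u\sigma_2u\cdots u\sigma_ku\;\tau\;v^k\;\beta$. *)

(* Defs.v *)
From HB Require Import structures.
From mathcomp Require Import all_boot all_order all_algebra.
From mathcomp Require Import boolp classical_sets functions.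

Set Implicit Arguments.
Unset Strict Implicit.
Unset Printing Implicit Defensive.

Import Order.TTheory GRing.Theory Num.Theory.

Local Open Scope ring_scope.
Local Open Scope classical_set_scope.

(** * Inversion sequences (entry [e_j] is [nth 0 e j.-1]) *)

Definition inv_seq (n : nat) (e : seq nat) : Prop :=
  size e = n /\ forall i, (i < n)%N -> (nth 0 e i <= i)%N.

Definition avoids102 (e : seq nat) : Prop :=
  forall i j k, (i < j)%N -> (j < k)%N -> (k < size e)%N ->
    ~ ((nth 0 e j < nth 0 e i)%N /\ (nth 0 e i < nth 0 e k)%N).

Definition IS102 (n : nat) : set (seq nat) :=
  [set e | inv_seq n e /\ avoids102 e].

Definition maxe (e : seq nat) : nat := \max_(x <- e) x.

(* The out-of-range default -1 implements the convention e_{n+1} = -1. *)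
Definition entry (e : seq nat) (i : nat) : int := nth (-1) (map Posz e) i.

Definition fdes (e : seq nat) : nat :=
  (find (fun i => entry e i.+1 < entry e i) (iota 0 (size e))).+1.

Definition rank (e : seq nat) : int := (fdes e)%:Z - (maxe e)%:Z - 1.

(** * Lattice paths, as sequences of step vectors starting at the origin *)

Definition vertex (w : seq (int * int)) (i : nat) : int * int :=
  \sum_(s <- take i w) s.

Definition endpoint (w : seq (int * int)) : int * int := vertex w (size w).

(** * 2-Schroeder paths

    Regions such as y >= 2x are convex, so it is enough to constrain the
    vertices of a path. *)

Inductive sstep := NStep | EStep | HStep.

Definition sstep_eqb (s t : sstep) : bool :=
  match s, t with
  | NStep, NStep | EStep, EStep | HStep, HStep => true
  | _, _ => false
  end.

Lemma sstep_eqP : Equality.axiom sstep_eqb.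
Proof. by do 2!case; constructor. Qed.

HB.instance Definition _ := hasDecEq.Build sstep sstep_eqP.

Definition svec (s : sstep) : int * int :=
  match s with
  | NStep => (0, 1)
  | EStep => (1, 0)
  | HStep => (1, 1)
  end.

Definition schroder2 (n : nat) (P : seq sstep) : Prop :=
  endpoint (map svec P) = (n%:Z, 2 * n%:Z) /\
  forall i, 2 * (vertex (map svec P) i).1 <= (vertex (map svec P) i).2.

Definition SP (n : nat) : set (seq sstep) :=
  [set P | [/\ schroder2 n P,
               ~~ infix [:: NStep; EStep] P,
               ~~ infix [:: EStep; NStep] P
             & suffix [:: HStep] P]].

Definition block (P : seq sstep) : nat :=
  count (fun i => (nth NStep P i == HStep) &&
                  ((vertex (map svec P) i.+1).2
                     == 2 * (vertex (map svec P) i.+1).1))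
        (iota 0 (size P)).

(** * UVD paths *)

Inductive ustep := UStep | VStep | DStep.

Definition ustep_eqb (s t : ustep) : bool :=
  match s, t with
  | UStep, UStep | VStep, VStep | DStep, DStep => true
  | _, _ => false
  end.

Lemma ustep_eqP : Equality.axiom ustep_eqb.
Proof. by do 2!case; constructor. Qed.

HB.instance Definition _ := hasDecEq.Build ustep ustep_eqP.

Definition uvec (s : ustep) : int * int :=
  match s with
  | UStep => (1, 1)
  | VStep => (0, -2)
  | DStep => (1, -1)
  end.

Definition UVD (n : nat) : set (seq ustep) :=
  [set S | [/\ endpoint (map uvec S) = (2 * n%:Z, 0),
               forall i, 0 <= (vertex (map uvec S) i).2,
               ~~ infix [:: UStep; VStep] S,
               ~~ infix [:: VStep; UStep] S
             & suffix [:: DStep] S]].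

Definition M : seq sstep -> seq ustep :=
  map (fun s => match s with
                | NStep => UStep
                | EStep => VStep
                | HStep => DStep
                end).

(** * Labeled F-paths *)

Definition Fstep (s : int * int) : bool :=
  ((0 <= s.1) && (s.2 == 1)) || ((1 <= s.1) && (s.2 <= 0)).

Definition Fpath (w : seq (int * int)) : Prop :=
  all Fstep w /\ forall i, (vertex w i).1 <= (vertex w i).2.

(* The pair (a, [:: b_1; ...; b_k]) is the label (a; b_1, ..., b_k); it
   determines its step (a, b_1 + ... + b_k), so a labeled F-path is encoded by
   the sequence of its labels.  Since (a; 1) has k = 1, the semilength of a
   step is k in all cases. *)
Definition flabel : Type := (nat * seq int)%type.

Definition up_label (l : flabel) : bool := l.2 == [:: 1].

Definition down_label (l : flabel) : bool :=
  [&& (1 <= l.1)%N, (1 <= size l.2)%N & all (fun b : int => b <= 0) l.2].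

Definition fvec (l : flabel) : int * int := (l.1%:Z, \sum_(b <- l.2) b).

Definition semilength (Q : seq flabel) : nat := \sum_(l <- Q) size l.2.

Definition LF (n : nat) : set (seq flabel) :=
  [set Q | [/\ Fpath (map fvec Q),
               all (fun l => up_label l || down_label l) Q
             & semilength Q = n]].

Definition height (Q : seq flabel) : int :=
  (endpoint (map fvec Q)).2 - (endpoint (map fvec Q)).1.

(** * The map phi *)

(* Inserts, for each j in js, one copy of m right after e_j; the positions j
   (counted from 1) refer to e before any insertion. *)
Definition insert_after (e : seq nat) (js : seq int) (m : nat) : seq nat :=
  flatten [seq nth 0%N e t.-1 :: nseq (count_mem t%:Z js) m
          | t <- iota 1 (size e)].

Definition phi_step (e : seq nat) (l : flabel) : seq nat :=
  let: (a, bs) := l in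
  let p := (fdes e)%:Z in
  let m := (maxe e + a)%N in
  if up_label l then insert_after e [:: p] m
  else
    let js := (p + \sum_(b <- bs) b - 1)
      :: [seq p + \sum_(b <- drop i bs) b | i <- iota 1 (size bs).-1] in
    insert_after e js m.

Definition phi (Q : seq flabel) : seq nat := foldl phi_step [:: 0%N] Q.

Lemma phi_rcons (Q : seq flabel) (l : flabel) :
  phi (rcons Q l) = phi_step (phi Q) l.
Proof. by rewrite /phi foldl_rcons. Qed.

(** * The map psi *)

(* Indices of the returns, counted from 1. *)
Definition returns (S : seq ustep) : seq nat :=
  [seq i <- iota 1 (size S) |
     (nth UStep S i.-1 == DStep) && ((vertex (map uvec S) i).2 == 0)].

(* Index of the r-th return, with index 0 for r = 0.  Only arguments r with
   0 <= r <= (number of returns) occur when psi is applied to an element of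
   [LF n]. *)
Definition return_index (S : seq ustep) (r : int) : nat :=
  nth 0%N (0%N :: returns S) `|r|%N.

(* s_{i+1} ... s_j *)
Definition segment (S : seq ustep) (i j : nat) : seq ustep := drop i (take j S).

Definition psi_step (S : seq ustep) (h : int) (l : flabel) : seq ustep :=
  let: (a, bs) := l in
  if up_label l then
    let p := return_index S (h + 1 - a%:Z) in
    take p S ++ [:: UStep] ++ drop p S ++ [:: DStep]
  else
    let k := size bs in
    let j i := return_index S (h + 1 + \sum_(b <- drop i bs) b - a%:Z) in
    (* subtract the length of the maximal run of v's ending at s_{j_0 - 1} *)
    let p := ((j 0).-1 - find (predC1 VStep) (rev (take (j 0).-1 S)))%N in
    take p S
      ++ flatten [seq [:: UStep] ++ segment S (j i) (j i.+1) ++ [:: UStep]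
                 | i <- iota 0 k]
      ++ drop (j k) S ++ nseq k VStep ++ segment S p (j 0).

Fixpoint psi_rev (Qr : seq flabel) : seq ustep :=
  if Qr is l :: Qr' then psi_step (psi_rev Qr') (height (rev Qr')) l
  else [:: UStep; DStep].

Definition psi (Q : seq flabel) : seq ustep := psi_rev (rev Q).

Lemma psi_rcons (Q : seq flabel) (l : flabel) :
  psi (rcons Q l) = psi_step (psi Q) (height Q) l.
Proof. by rewrite /psi rev_rcons /= revK. Qed.

(* Inverse of psi : LF n.-1 -> UVD n, with an arbitrary value outside the
   image. *)
Definition psi_inv (n : nat) : seq ustep -> seq flabel :=
  'pinv_(fun=> [::]) (LF n.-1) psi.

(* Main.v *)
(* Both phi and psi are computed by adding one label at a time, so each is
   bijective as soon as a single step can be undone in exactly one way.  A common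
   invariant tracks the height: rank(phi(Q)) = height(Q), and psi(Q) has
   height(Q) + 1 returns, which yields the refined statement.

   For phi, the last label inserts copies of a new or repeated maximum m.  If m
   stands twice just before the first descent, the last step was (0;1);
   otherwise deleting every m gives back the previous sequence, and the blocks
   between the copies of m give the label.

   For psi, write a nonempty path as T v^q d with q maximal.  If q = 0, the last
   step was (a;1) and the last visit of T to the axis gives alpha and beta.  If
   q > 0, last-passage decompositions from the top downwards peel off tau,
   sigma_k, ..., sigma_1, and stop as soon as what remains does not end with u
   or has height 1. *)

Require Import Defs.
From mathcomp Require Import all_boot all_order all_algebra.
From mathcomp Require Import boolp classical_sets functions.
From mathcomp Require Import zify.

Set Implicit Arguments.
Unset Strict Implicit.
Unset Printing Implicit Defensive.

Import Order.TTheory GRing.Theory Num.Theory.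

Local Open Scope ring_scope.

(** Since the height of a path can be read off its image, each recursion step depends only on the
    current object and the label, and one induction serves both maps. For [phi], deleting m can be
    reversed because 102-avoidance forces the entries other than m that precede an m to increase
    weakly. They form a prefix of the first run of the shorter sequence, so every m stands where
    some label could have put it. A label with a = 0 can only be (0;1), the one case in which m is
    not new. For [psi], a block u sigma u rises by two and a step v falls by two, so k blocks are
    paid for by v^k. Upward steps rise by one only, so the path leaves each intermediate height for
    the last time by a u. The stopping rule of the peeling is forced: if r > 0 steps v follow alpha
    in the source, alpha must end with d because uv is forbidden; if r = 0, alpha has height 1. *)

Definition label_incr (l : flabel) : int := \sum_(b <- l.2) b - l.1%:Z.

Definition valid_label (h : int) (l : flabel) : bool :=
  (up_label l || down_label l) && (0 <= h + label_incr l).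

(** * Labeled paths built one label at a time *)

Lemma vertexE (T : Type) (f : T -> int * int) (w : seq T) (i : nat) :
  vertex (map f w) i =
    (\sum_(s <- take i w) (f s).1, \sum_(s <- take i w) (f s).2).
Proof.
rewrite /vertex -map_take big_map.
by elim: (take i w) => [|s v IH]; rewrite ?big_nil // !big_cons IH.
Qed.

Lemma endpointE (T : Type) (f : T -> int * int) (w : seq T) :
  endpoint (map f w) = (\sum_(s <- w) (f s).1, \sum_(s <- w) (f s).2).
Proof. by rewrite /endpoint vertexE size_map take_size. Qed.

Lemma height_nil : height [::] = 0.
Proof. by rewrite /height endpointE !big_nil. Qed.

Lemma height_rcons (Q : seq flabel) (l : flabel) :
  height (rcons Q l) = height Q + label_incr l.
Proof.
rewrite /height !endpointE -!cats1 !big_cat !big_seq1 /= /label_incr.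
by rewrite opprD addrACA.
Qed.

Lemma semilength_rcons (Q : seq flabel) (l : flabel) :
  semilength (rcons Q l) = (semilength Q + size l.2)%N.
Proof. by rewrite /semilength -cats1 big_cat big_seq1. Qed.

Lemma down_label_sum (l : flabel) : down_label l -> \sum_(b <- l.2) b <= 0.
Proof. by case/and3P=> _ _ /allP h; rewrite big_seq; apply: sumr_le0. Qed.

Lemma label_size_gt0 (l : flabel) :
  up_label l || down_label l -> (0 < size l.2)%N.
Proof. by case/orP => [/eqP->|/and3P[]]. Qed.

Lemma label_Fstep (l : flabel) : up_label l || down_label l -> Fstep (fvec l).
Proof.
case/orP => [/eqP e|h]; rewrite /Fstep /fvec /=.
  by rewrite e big_seq1.
by rewrite (down_label_sum h) andbT; case/and3P: h => h1 _ _; lia.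
Qed.

Lemma LF_nil (n : nat) : LF n [::] <-> n = 0%N.
Proof.
rewrite /LF /= /semilength big_nil; split=> [[]//|->]; split=> //; split=> // i.
by rewrite /vertex big_nil.
Qed.

(** Only one new vertex has to be checked against the diagonal, and its position relative to the
    diagonal is the new height. The conditions on a whole path thus become [valid_label] at each
    step. *)
Lemma LF_rcons (n : nat) (Q : seq flabel) (l : flabel) :
  LF n (rcons Q l) <->
  [/\ valid_label (height Q) l, (size l.2 <= n)%N & LF (n - size l.2) Q].
Proof.
rewrite /LF /=; split.
  case=> [[_ hv]]; rewrite all_rcons semilength_rcons => /andP[hl hQ] <-.
  split; last 2 first.
  - by rewrite leq_addl.
  - rewrite addnK; split=> //; split.
      by apply/allP => _ /mapP[x xQ ->]; apply: label_Fstep; move/allP: hQ; apply.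
    move=> i; case: (leqP i (size Q)) => hi.
      by have := hv i; rewrite !vertexE -cats1 takel_cat.
    have := hv (size Q); rewrite !vertexE -cats1 takel_cat //.
    by rewrite take_size (take_oversize (ltnW hi)).
  rewrite /valid_label hl -height_rcons /height /endpoint subr_ge0.
  exact: hv.
case=> /andP[hl hh] hs [[_ hv] hQ hn]; split.
- split.
    apply/allP => _ /mapP[x + ->]; rewrite mem_rcons inE => /predU1P[->|xQ].
      exact: label_Fstep.
    by apply: label_Fstep; move/allP: hQ; apply.
  move=> i; case: (leqP i (size Q)) => hi.
    by have := hv i; rewrite !vertexE -cats1 takel_cat.
  move: hh; rewrite -height_rcons /height endpointE subr_ge0 !vertexE.
  by rewrite take_oversize // size_rcons.
- by rewrite all_rcons hl.
- by rewrite semilength_rcons hn subnK.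
Qed.

(* Since the last label and the image of the truncated path are recovered from
   each image, it is enough to study one step of the recursion. *)
Lemma bij_from_steps (T : Type) (t0 : T) (step : T -> flabel -> T)
    (f : seq flabel -> T) (OK : nat -> T -> Prop) (ht : T -> int) :
  f [::] = t0 ->
  (forall Q l, ht (f Q) = height Q -> f (rcons Q l) = step (f Q) l) ->
  OK 1%N t0 -> ht t0 = 0 ->
  (forall n t l, (0 < n)%N -> OK n t -> valid_label (ht t) l ->
    OK (n + size l.2)%N (step t l) /\ ht (step t l) = ht t + label_incr l) ->
  (forall n t l n' t' l', (0 < n)%N -> (0 < n')%N -> OK n t -> OK n' t' ->
    valid_label (ht t) l -> valid_label (ht t') l' ->
    step t l = step t' l' -> t = t' /\ l = l') ->
  (forall n t, (0 < n)%N -> OK n t -> (n = 1%N /\ t = t0) \/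
    exists m t' l, [/\ (0 < m)%N, OK m t', valid_label (ht t') l, t = step t' l &
                       n = (m + size l.2)%N]) ->
  (forall n, set_bij (LF n) (OK n.+1) f) /\
  (forall n Q, LF n Q -> ht (f Q) = height Q).
Proof.
move=> f0 fS OK0 ht0 stepOK step_inj step_surj.
have fOK n Q : LF n Q -> OK n.+1 (f Q) /\ ht (f Q) = height Q.
  elim/last_ind: Q n => [|Q l IH] n.
    by move/LF_nil->; rewrite f0 ht0 height_nil.
  case/LF_rcons => hv hn /IH[ok1 e1].
  rewrite fS // height_rcons -e1 -(subnK hn) -addSn.
  by apply: stepOK; rewrite // e1.
split=> [n|n Q /fOK[]//]; split.
- by move=> Q /fOK[].
- move=> Q Q'; rewrite !inE => hQ hQ'.
  elim/last_ind: Q n Q' hQ hQ' => [|Q l IH] n Q'.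
    move/LF_nil->; case/lastP: Q' => // Q' l /LF_rcons[/andP[/label_size_gt0 h _]].
    by move: h; case: (size _).
  case/lastP: Q' => [|Q' l'].
    move=> + /LF_nil n0; rewrite {}n0.
    by case/LF_rcons => /andP[/label_size_gt0 h _]; move: h; case: (size _).
  case/LF_rcons => hv hs hQ /LF_rcons[hv' hs' hQ'].
  have [[o1 e1] [o2 e2]] := (fOK _ _ hQ, fOK _ _ hQ').
  rewrite !fS // => es.
  have [eQ el] : f Q = f Q' /\ l = l'.
    by apply: step_inj o1 o2 _ _ es; rewrite ?e1 ?e2.
  by congr rcons => //; apply: (IH _ _ hQ); rewrite // el.
(* Strong induction works because every label has positive semilength, so undoing a step decreases
   n. *)
- move=> t; elim/ltn_ind: n t => n IH t /step_surj -/(_ isT)[].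
    by case=> -[->] ->; exists [::] => //; apply/LF_nil.
  case=> -[|m] [t' [l [// _ om hv -> e]]].
  have hl : (0 < size l.2)%N by apply: label_size_gt0; case/andP: hv.
  case: (IH m _ t' om); first by lia.
  move=> Q hQ eQ; have [o1 e1] := fOK _ _ hQ.
  exists (rcons Q l); last by rewrite fS // eQ.
  apply/LF_rcons; rewrite -e1 eQ; split=> //; first by lia.
  by rewrite (_ : (n - _)%N = m) //; lia.
Qed.

(** * The map phi *)

Lemma subseq_nth3 (T : eqType) (x0 : T) (e : seq T) (i j k : nat) :
  (i < j)%N -> (j < k)%N -> (k < size e)%N ->
  subseq [:: nth x0 e i; nth x0 e j; nth x0 e k] e.
Proof.
have sub a s : (a < size e)%N -> subseq s (drop a.+1 e) ->
    subseq (nth x0 e a :: s) (drop a e).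
  by move=> ha hs; rewrite (drop_nth x0 ha) /= eqxx.
have mono a b s : (a <= b)%N -> subseq s (drop b e) -> subseq s (drop a e).
  move=> /subnK <- h; apply: subseq_trans h _; rewrite -drop_drop.
  exact: drop_subseq.
move=> ij jk ke; rewrite -[X in subseq _ X]drop0; apply: (mono 0%N i) => //.
apply: (sub _ _); first by lia.
apply: (mono _ j) => //; apply: (sub _ _); first by lia.
apply: (mono _ k) => //; apply: (sub _ _) => //.
exact: sub0seq.
Qed.

Lemma subseq_consP (T : eqType) (x : T) (s e : seq T) :
  subseq (x :: s) e -> exists e1 e2, e = e1 ++ x :: e2 /\ subseq s e2.
Proof.
elim: e => [|y e IH] //=; case: eqP => [->|_].
  by move=> h; exists [::], e.
by case/IH => e1 [e2 [-> h]]; exists (y :: e1), e2.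
Qed.

Lemma subseq_rconsP (T : eqType) (x : T) (s e : seq T) :
  subseq (rcons s x) e -> exists e1 e2, e = e1 ++ x :: e2 /\ subseq s e1.
Proof.
rewrite -subseq_rev rev_rcons => /subseq_consP[e1 [e2 [he hs]]].
exists (rev e2), (rev e1); split.
  by rewrite -(revK e) he rev_cat rev_cons cat_rcons.
by rewrite -subseq_rev revK.
Qed.

(** Subsequences behave well under filtering and concatenation, which spares the index shifts caused
    by inserting or deleting entries. *)
Lemma avoids102P (e : seq nat) :
  avoids102 e <->
  forall x y z, (y < x)%N -> (x < z)%N -> ~~ subseq [:: x; y; z] e.
Proof.
split=> [h x y z yx xz|h i j k ij jk ke [h1 h2]]; last first.
  by have := h _ _ _ h1 h2; rewrite subseq_nth3.
apply/negP => /subseq_consP[e1 [? [he /subseq_consP[e2 [? [he' hz]]]]]].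
case/subseq_consP: hz => e3 [e4 [he'' _]]; subst.
have := h (size e1) (size (e1 ++ x :: e2)) (size (e1 ++ x :: e2 ++ y :: e3)).
rewrite !size_cat /= !size_cat /= !size_cat /=; case; [lia|lia|lia|].
have -> : nth 0%N (e1 ++ x :: e2 ++ y :: e3 ++ z :: e4) (size e1) = x.
  by rewrite nth_cat ltnn subnn.
have -> : nth 0%N (e1 ++ x :: e2 ++ y :: e3 ++ z :: e4)
            (size e1 + (size e2).+1) = y.
  by rewrite -(cat_cons x) catA nth_cat size_cat /= ltnn subnn.
have -> : nth 0%N (e1 ++ x :: e2 ++ y :: e3 ++ z :: e4)
            (size e1 + (size e2 + (size e3).+1).+1) = z.
  rewrite -(cat_cons y) -(cat_cons x) !catA nth_cat !size_cat /=.
  by rewrite -(addSn (size e2)) addnA ltnn subnn.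
by [].
Qed.

Definition drop_val (m : nat) : seq nat -> seq nat := filter (predC1 m).

Lemma drop_val_cat (m : nat) (x y : seq nat) :
  drop_val m (x ++ y) = drop_val m x ++ drop_val m y.
Proof. exact: filter_cat. Qed.

Lemma drop_val_cons (m : nat) (y : seq nat) :
  drop_val m (m :: y) = drop_val m y.
Proof. by rewrite /drop_val /= eqxx. Qed.

Lemma drop_val_id (m : nat) (e : seq nat) : m \notin e -> drop_val m e = e.
Proof.
by move=> h; apply/all_filterP/allP => x /=; apply: contraTneq => ->.
Qed.

Lemma drop_val_notin (m : nat) (e : seq nat) : m \notin drop_val m e.
Proof. by rewrite mem_filter /= eqxx. Qed.

(* Only 102-patterns whose 2 is a maximal entry are not seen after deleting the
   maximal entries. *)
Lemma avoids102_max (m : nat) (e : seq nat) : all (leq^~ m) e ->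
  avoids102 e <->
  avoids102 (drop_val m e) /\
  forall w1 w2, e = w1 ++ m :: w2 -> sorted leq (drop_val m w1).
Proof.
move=> hm; split=> [/avoids102P h|[/avoids102P h1 h2]].
  split.
    apply/avoids102P => x y z yx xz; apply: contra (h _ _ _ yx xz) => hs.
    by apply: subseq_trans hs (filter_subseq _ _).
  move=> w1 w2 he; set w := drop_val m w1.
  have hw : all (leq^~ m) w1 by move: hm; rewrite he all_cat => /andP[].
  (* A strict decrease among the entries of [w], all smaller than m, would form a 102 pattern with
     the m that follows [w1]. *)
  rewrite (sorted_pairwise leq_trans); apply/(pairwiseP 0%N) => i j hi hj ij.
  rewrite leqNgt; apply/negP => lt.
  have := h _ _ m lt; rewrite he => /(_ _)/negP[].
    have : nth 0%N w i \in w by apply: mem_nth.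
    rewrite mem_filter /= => /andP[h1 /(allP hw)]; lia.
  rewrite -[[:: _; _; _]]/([:: nth 0%N w i; nth 0%N w j] ++ [:: m]) cat_subseq //.
    apply: subseq_trans (filter_subseq (predC1 m) w1); rewrite -/(drop_val m w1) -/w.
    rewrite -[X in subseq _ X](cat_take_drop j w); apply: (@cat_subseq _ [:: _] [:: _]).
      rewrite sub1seq -(nth_take 0%N ij).
      by rewrite mem_nth // size_takel // ltnW.
    by rewrite sub1seq (drop_nth 0%N) ?mem_head.
  by rewrite sub1seq mem_head.
apply/avoids102P => x y z yx xz; apply/negP => hs.
have hz : (z <= m)%N.
  by move/allP: hm; apply; apply: (mem_subseq hs); rewrite !inE eqxx !orbT.
(* If z = m, then x and y survive the deletion and contradict sortedness before this m; if z < m,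
   the whole pattern survives. *)
have [ezm|nzm] := eqVneq z m.
  move: hs; rewrite ezm -[[:: x; y; m]]/(rcons [:: x; y] m).
  case/subseq_rconsP => w1 [w2 [he hs]].
  have hf : subseq [:: x; y] (drop_val m w1).
    by rewrite subseq_filter hs andbT /= andbT; apply/andP; split; lia.
  by have := subseq_sorted leq_trans hf (h2 _ _ he); rewrite /= leqNgt yx.
have /negP[] := h1 _ _ _ yx xz; rewrite subseq_filter hs andbT /= nzm.
by rewrite !andbT; apply/andP; split; lia.
Qed.

(** [x] is the longest weakly increasing prefix of [x ++ y]. An empty [y] stands for the descent to
    the conventional last entry -1. *)
Definition first_run (x y : seq nat) : bool :=
  [&& x != [::], sorted leq x & nilp y || (head 0%N y < last 0%N x)%N].

Lemma first_run_exists (e : seq nat) : e != [::] ->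
  exists x y, e = x ++ y /\ first_run x y.
Proof.
elim: e => [|a [|b e] IH] // _; first by exists [:: a], [::].
have [[|c x] [y [exy hr]]] := IH isT; first by case/and3P: hr.
case: exy hr => <- exy /and3P[_ hs hl].
have [ab|ba] := leqP a b.
  exists [:: a, b & x], y; split; first by rewrite exy.
  by move: hs hl; rewrite /first_run /= ab => -> ->.
by exists [:: a], [:: b & e]; rewrite /first_run /= ba.
Qed.

Lemma fdes_cons (a b : nat) (w : seq nat) :
  fdes [:: a, b & w] = if (b < a)%N then 1%N else (fdes (b :: w)).+1.
Proof.
have e : iota 0 (size [:: a, b & w]) = 0%N :: map S (iota 0 (size (b :: w))).
  by congr cons; apply: (iotaDl 1 0 (size (b :: w))).
have findE P s : find P (0%N :: s) = if P 0%N then 0%N else (find P s).+1 by [].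
by rewrite /fdes e findE find_map /entry /= ltz_nat; case: ltnP.
Qed.

Lemma fdes_first_run (x y : seq nat) : first_run x y -> fdes (x ++ y) = size x.
Proof.
case/and3P; elim: x => [|a x IH] // _; case: x IH => [|b x] IH hs hl.
  move: hl; case: y {IH} => [|c y] //=.
  by rewrite /nilp /= fdes_cons => ->.
rewrite !cat_cons fdes_cons; move: hs => /= /andP[ab hs].
by rewrite ltnNge ab /= -cat_cons IH.
Qed.

Lemma maxeP (e : seq nat) (m : nat) :
  m \in e -> all (leq^~ m) e -> maxe e = m.
Proof.
move=> me /allP h; apply/anti_leq/andP; split.
  by apply/bigmax_leqP_seq => x xe _; apply: h.
exact: (@leq_bigmax_seq _ _ _ id).
Qed.

(** A later entry above the last entry of [x] would complete a 102 pattern with that entry and the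
    descent bottom right after it. *)
Lemma first_run_max (x y : seq nat) : first_run x y -> avoids102 (x ++ y) ->
  all (leq^~ (last 0%N x)) (x ++ y).
Proof.
case/and3P; case/lastP: x => // x m _ hs; rewrite last_rcons => hy /avoids102P h.
rewrite all_cat; apply/andP; split.
  move: hs; rewrite (sorted_pairwise leq_trans) pairwise_rcons all_rcons.
  by case/andP => -> _; rewrite leqnn.
case: y hy h => [|c y] //=; rewrite /nilp /= => cm h; rewrite (ltnW cm) /=.
apply/allP => z zy; rewrite leqNgt; apply/negP => mz.
have /negP[] := h _ _ _ cm mz; rewrite cat_rcons.
apply: subseq_trans (suffix_subseq _ _); rewrite /= !eqxx.
by rewrite sub1seq.
Qed.

Lemma IS102_run (n : nat) (e : seq nat) : (0 < n)%N -> IS102 n e ->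
  exists x y, [/\ e = x ++ y, first_run x y, fdes e = size x,
                  maxe e = last 0%N x & all (leq^~ (last 0%N x)) e].
Proof.
move=> n0 [[he _] ha]; have e0 : e != [::] by case: e he {ha} n0 => // <-.
have [x [y [exy hr]]] := first_run_exists e0; exists x, y; subst e.
have hm := first_run_max hr ha.
split=> //; first exact: fdes_first_run.
apply: maxeP => //; rewrite mem_cat.
by case/and3P: hr; case: (x) => //= a x' _ _ _; rewrite mem_last.
Qed.

(* A label (a; b_1, ..., b_k) inserts its k new maxima so that, read from the
   left, they are separated by |b_1|+1, |b_2|, ..., |b_k| old entries, the last
   block ending at the first descent; [weave] performs these insertions from
   right to left. *)
Fixpoint weave (e : seq nat) (m p : nat) (cs : seq nat) : seq nat :=
  if cs is c :: cs' then
    take (p - sumn cs) e ++ m :: drop (p - sumn cs) (weave e m p cs')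
  else e.

Lemma weave_cons (e : seq nat) (m p c : nat) (cs : seq nat) :
  weave e m p (c :: cs) = take (p - sumn (c :: cs)) e ++
    m :: drop (p - sumn (c :: cs)) (weave e m p cs).
Proof. by []. Qed.

Lemma take_weave (e : seq nat) (m p q : nat) (cs : seq nat) :
  (p <= size e)%N -> (q <= p - sumn cs)%N ->
  take q (weave e m p cs) = take q e.
Proof.
move=> pe; case: cs => [|c cs] // hq; rewrite weave_cons.
rewrite takel_cat; last by rewrite size_takel //; lia.
by rewrite take_takel.
Qed.

(** The insertions for [cs] all lie at or to the right of position q, so the count c only adds one m
    at q. This form drives the inductions on [cs] below. *)
Lemma weave_cons_eq (e : seq nat) (m p c : nat) (cs : seq nat) :
  (p <= size e)%N -> let q := (p - sumn (c :: cs))%N in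
  exists W, weave e m p (c :: cs) = take q e ++ m :: W /\
            weave e m p cs = take q e ++ W.
Proof.
move=> pe q; exists (drop q (weave e m p cs)); split; first by [].
by rewrite -(@take_weave e m p q cs) ?cat_take_drop // /q /=; lia.
Qed.

Lemma drop_val_weave (e : seq nat) (m p : nat) (cs : seq nat) :
  (p <= size e)%N -> drop_val m (weave e m p cs) = drop_val m e.
Proof.
move=> pe; elim: cs => [|c cs <-] //.
have [W [-> ->]] := weave_cons_eq m c cs pe.
by rewrite !drop_val_cat drop_val_cons.
Qed.

Lemma size_weave (e : seq nat) (m p : nat) (cs : seq nat) :
  (p <= size e)%N -> size (weave e m p cs) = (size e + size cs)%N.
Proof.
move=> pe; elim: cs => [|c cs IH]; first by rewrite addn0.
have [W [-> eW]] := weave_cons_eq m c cs pe.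
by rewrite [size (_ :: _)]/= !addnS -IH eW !size_cat /= addnS.
Qed.

Lemma all_weave (e : seq nat) (m p : nat) (cs : seq nat) :
  (p <= size e)%N -> all (leq^~ m) e -> all (leq^~ m) (weave e m p cs).
Proof.
move=> pe he; elim: cs => [|c cs IH] //.
have [W [-> eW]] := weave_cons_eq m c cs pe.
by move: IH; rewrite eW !all_cat /= leqnn.
Qed.

Lemma cat_cons_inv (T : eqType) (x y w1 w2 : seq T) (a b : T) :
  x ++ a :: y = w1 ++ b :: w2 -> (exists w, x = w1 ++ w) \/
  exists w, w1 = x ++ a :: w /\ y = w ++ b :: w2.
Proof.
elim: x w1 => [|c x IH] [|d w1] /=.
- by left; exists [::].
- by case=> <- ->; right; exists w1.
- by left; exists (c :: x).
- by case=> <- /IH[[w ->]|[w [-> ->]]]; [left|right]; exists w.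
Qed.

Lemma cat_cons_notin (T : eqType) (x y w1 w2 : seq T) (b : T) :
  b \notin x -> x ++ y = w1 ++ b :: w2 ->
  exists w, w1 = x ++ w /\ y = w ++ b :: w2.
Proof.
elim: x w1 => [|c x IH] w1 /=; first by move=> _ ->; exists w1.
rewrite inE negb_or => /andP[bc bx]; case: w1 => [|d w1] /=.
  by case=> cb; rewrite cb eqxx in bc.
by case=> <- /(IH _ bx)[w [-> ->]]; exists w.
Qed.

(** With [weave_surj] this characterizes weaves: an m may stand anywhere with at most p other
    entries before it. A chosen m is either the leftmost one, with q <= p entries before it, or
    remains in the smaller weave when the leftmost is removed. *)
Lemma weave_prefix (e : seq nat) (m p : nat) (cs : seq nat) (w1 w2 : seq nat) :
  (p <= size e)%N -> m \notin e -> weave e m p cs = w1 ++ m :: w2 ->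
  (size (drop_val m w1) <= p)%N.
Proof.
move=> pe me; elim: cs w1 w2 => [|c cs IH] w1 w2.
  by move=> /= h; move: me; rewrite h mem_cat mem_head orbT.
have [W [-> eW]] := weave_cons_eq m c cs pe.
case/cat_cons_inv => [[w hw]|[w [-> ew]]].
  rewrite size_filter; apply: leq_trans (count_size _ _) _.
  have := congr1 size hw; rewrite size_takel ?(leq_trans (leq_subr _ _)) //.
  rewrite size_cat => h; apply: leq_trans (leq_subr (sumn (c :: cs)) p).
  by rewrite h leq_addr.
rewrite drop_val_cat drop_val_cons -drop_val_cat; apply: (IH _ w2).
by rewrite eW ew catA.
Qed.

(** As m does not occur in [e], the index of the first m gives the total of the counts; removing
    that m leaves the weave of the remaining counts. *)
Lemma weave_inj (e : seq nat) (m p : nat) (cs cs' : seq nat) :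
  (p <= size e)%N -> m \notin e -> (sumn cs <= p)%N -> (sumn cs' <= p)%N ->
  weave e m p cs = weave e m p cs' -> cs = cs'.
Proof.
move=> pe me; elim: cs cs' => [|c cs IH] [|c' cs'] // hs hs' he.
- have := congr1 size he; rewrite !size_weave //=; lia.
- have := congr1 size he; rewrite !size_weave //=; lia.
have [W [eW1 eW2]] := weave_cons_eq m c cs pe.
have [W' [eW1' eW2']] := weave_cons_eq m c' cs' pe.
have nt q : m \notin take q e by apply: contra me; apply: mem_take.
have idx q X : (q <= p)%N -> index m (take q e ++ m :: X) = q.
  move=> hq; rewrite index_cat (negbTE (nt q)) /= eqxx addn0 size_takel //.
  exact: leq_trans pe.
have hq : (p - sumn (c :: cs))%N = (p - sumn (c' :: cs'))%N.
  by have := congr1 (index m) he; rewrite eW1 eW1' !idx ?leq_subr.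
have ecs : cs = cs'.
  apply: IH; [move: hs => /=; lia|move: hs' => /=; lia|].
  move: he; rewrite eW1 eW1' eW2 eW2' hq => /eqP.
  by rewrite eqseq_cat // eqseq_cons !eqxx /= => /eqP->.
rewrite -ecs; congr cons; move: hq hs hs'; rewrite -ecs /=; lia.
Qed.

Lemma weave_surj (m p : nat) (w : seq nat) :
  (p <= size (drop_val m w))%N ->
  (forall w1 w2, w = w1 ++ m :: w2 -> (size (drop_val m w1) <= p)%N) ->
  exists cs, (sumn cs <= p)%N /\ w = weave (drop_val m w) m p cs.
Proof.
have [k] := ubnP (size w); elim: k w => // k IH w wk pw hw.
have [mw|mw] := boolP (m \in w); last first.
  by exists [::]; rewrite drop_val_id.
have [x0 [Z [ew nx]]] : exists x0 Z, w = x0 ++ m :: Z /\ m \notin x0.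
  exists (take (index m w) w), (drop (index m w).+1 w); split.
    by rewrite -{2}(nth_index 0%N mw) -drop_nth ?index_mem // cat_take_drop.
  by apply/negP => /index_ltn; rewrite ltnn.
have de : drop_val m w = drop_val m (x0 ++ Z).
  by rewrite ew !drop_val_cat drop_val_cons.
have [|||cs [hs eW]] := IH (x0 ++ Z).
- by move: wk; rewrite ew !size_cat /=; lia.
- by rewrite -de.
- move=> w1 w2 /(cat_cons_notin nx)[w' [-> eZ]].
  have := hw (x0 ++ m :: w') w2; rewrite !drop_val_cat drop_val_cons; apply.
  by rewrite ew eZ -catA.
have pe : (p <= size (drop_val m (x0 ++ Z)))%N by rewrite -de.
have xp : (size x0 <= p)%N by have := hw _ _ ew; rewrite drop_val_id.
(* The removed m was the leftmost, so the next one, at [p - sumn cs], is not before it; the gap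
   between the two is the new first count. *)
have hx : (size x0 <= p - sumn cs)%N.
  case: cs hs eW => [|c cs] hs eW; first by rewrite subn0.
  have [W [eW1 _]] := weave_cons_eq m c cs pe.
  move: eW; rewrite eW1 => /(cat_cons_notin nx)[w' [e _]].
  have := congr1 size e; rewrite size_cat size_takel; last first.
    exact: leq_trans (leq_subr _ _) pe.
  by move->; rewrite leq_addr.
exists ((p - sumn cs - size x0)%N :: cs); rewrite de; split; first by move=> /=; lia.
rewrite weave_cons.
have -> : (p - sumn ((p - sumn cs - size x0)%N :: cs))%N = size x0 by move=> /=; lia.
by rewrite -(take_weave m pe hx) -eW take_size_cat // drop_size_cat.
Qed.

(** * From insertion positions to weaves *)

Lemma insert_after_absent (e : seq nat) (js : seq int) (m k : nat) :
  (k <= size e)%N -> (forall t, (0 < t <= k)%N -> t%:Z \notin js) ->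
  flatten [seq nth 0%N e t.-1 :: nseq (count_mem t%:Z js) m | t <- iota 1 k] =
  take k e.
Proof.
move=> ke h.
have -> : [seq nth 0%N e t.-1 :: nseq (count_mem t%:Z js) m | t <- iota 1 k] =
    [seq [:: x] | x <- [seq nth 0%N e t | t <- iota 0 k]].
  rewrite -map_comp -(addn0 1%N) iotaDl -map_comp.
  apply/eq_in_map => t; rewrite mem_iota /= => tk.
  by rewrite (count_memPn _) //; apply: h; lia.
by rewrite flatten_seq1 map_nth_iota0.
Qed.

Lemma insert_after_nil (e : seq nat) (m : nat) : insert_after e [::] m = e.
Proof. by rewrite /insert_after insert_after_absent // take_size. Qed.

(** The leftmost insertion can be performed last, since it does not disturb the positions of the
    others. Ties are harmless because all inserted entries are equal. *)
Lemma insert_after_cons (e : seq nat) (j : nat) (js : seq int) (m : nat) :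
  (0 < j <= size e)%N -> all (fun t => j%:Z <= t) js ->
  insert_after e (j%:Z :: js) m =
    take j e ++ m :: drop j (insert_after e js m).
Proof.
case: j => // j /= je /allP hjs; rewrite /insert_after.
have -> : iota 1 (size e) = iota 1 j ++ j.+1 :: iota j.+2 (size e - j.+1).
  by rewrite -[_ :: _]/(iota (1 + j) (size e - j.+1).+1) -iotaD; congr iota; lia.
rewrite !map_cat !flatten_cat.
rewrite !insert_after_absent; try lia; last 2 first.
- by move=> t ht; apply/negP => /hjs; lia.
- move=> t ht; rewrite inE negb_or; apply/andP; split; first by lia.
  by apply/negP => /hjs; lia.
rewrite /= (take_nth 0%N je) -cats1 -catA /= eqxx /=.
rewrite drop_cat size_takel; last exact: ltnW.
rewrite ltnNge leqnSn /= subSn // subnn /= drop0.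
congr (_ ++ _ :: _ :: _ ++ flatten _).
by apply/eq_in_map => t; rewrite mem_iota => ht; rewrite /= eqz_nat ltn_eqF //; lia.
Qed.

Lemma insert_after_weave (e : seq nat) (m p : nat) (cs : seq nat) :
  (sumn cs < p)%N -> (p <= size e)%N ->
  insert_after e [seq p%:Z - (sumn (drop i cs))%:Z | i <- iota 0 (size cs)] m =
  weave e m p cs.
Proof.
move=> + pe; elim: cs => [|c cs IH] hs; first by rewrite insert_after_nil.
rewrite weave_cons -IH; last by move: hs => /=; lia.
rewrite [size (c :: cs)]/= -[(size cs).+1]/(1 + size cs)%N iotaD map_cat.
rewrite (iotaDl 1 0) -map_comp [map _ (iota 0 1)]/= cat1s.
have -> : p%:Z - (sumn (c :: cs))%:Z = (p - sumn (c :: cs))%N%:Z by lia.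
rewrite insert_after_cons //.
  by lia.
apply/allP => _ /mapP[i _ ->] /=.
have : (sumn (drop i cs) <= sumn cs)%N.
  by rewrite -{2}(cat_take_drop i cs) sumn_cat leq_addl.
by move: hs; rewrite add0n /=; lia.
Qed.

(** The first count is 1 - b_1 for both kinds of label: the -1 in j_1 gives it for down labels, and
    b_1 = 1 gives 0 for up labels. A first count of 0 therefore marks exactly the up labels. *)
Definition label_counts (l : flabel) : seq nat :=
  if up_label l then [:: 0%N]
  else if l.2 is b :: bs then `|b|%N.+1 :: map absz bs else [::].

Lemma size_label_counts (l : flabel) :
  up_label l || down_label l -> size (label_counts l) = size l.2.
Proof.
rewrite /label_counts; case: ifP => [/eqP->|_] //.
by case: (l.2) => //= b bs _; rewrite size_map.
Qed.

Lemma sumn_absz (bs : seq int) : all (fun b : int => b <= 0) bs ->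
  (sumn (map absz bs))%:Z = - \sum_(b <- bs) b.
Proof.
elim: bs => [|b bs IH] /=; first by rewrite big_nil.
by case/andP => hb /IH; rewrite big_cons; move: (\sum_(_ <- _) _) => S; lia.
Qed.

Lemma sumn_label_counts (l : flabel) : up_label l || down_label l ->
  (sumn (label_counts l))%:Z = 1 - \sum_(b <- l.2) b.
Proof.
rewrite /label_counts; case: ifP => [/eqP->|_] /=; first by rewrite big_seq1.
case/and3P => _; case: (l.2) => //= b bs _ /andP[hb /sumn_absz].
by rewrite big_cons; move: (\sum_(_ <- _) _) => S; lia.
Qed.

Lemma label_counts_inj (a : nat) (bs bs' : seq int) :
  up_label (a, bs) || down_label (a, bs) ->
  up_label (a, bs') || down_label (a, bs') ->
  label_counts (a, bs) = label_counts (a, bs') -> bs = bs'.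
Proof.
have inj (s s' : seq int) : all (fun b : int => b <= 0) s ->
    all (fun b : int => b <= 0) s' -> map absz s = map absz s' -> s = s'.
  elim: s s' => [|b s IH] [|b' s'] //= /andP[hb hs] /andP[hb' hs'] [eb es].
  by congr cons; [lia|exact: IH].
rewrite /label_counts; case: ifP => [/eqP /= ->|_] /=; case: ifP => [/eqP /= ->|_] //=.
- by move=> _; case: bs' => //=; rewrite /down_label /= andbF.
- by case: bs => //=; rewrite /down_label /= andbF.
case: bs => [|b s]; rewrite /down_label /= ?andbF //.
case: bs' => [|b' s']; rewrite /= ?andbF //.
case/and3P => _ hb hs /and3P[_ hb' hs'] [eb es].
by congr cons; [lia|exact: inj].
Qed.

(** * One step of phi and its inverse *)

Lemma phi_stepE (e : seq nat) (l : flabel) :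
  up_label l || down_label l -> (sumn (label_counts l) < fdes e)%N ->
  (fdes e <= size e)%N ->
  phi_step e l = weave e (maxe e + l.1) (fdes e) (label_counts l).
Proof.
case: l => a bs hl hs pe; rewrite -insert_after_weave // /phi_step /label_counts.
case: ifP hl => [_ _|_] /=; first by rewrite subr0.
case/and3P => _; case: bs {hs} => //= b bs _ /andP[hb hbs].
congr (insert_after _ (_ :: _) _).
  by rewrite big_cons; have := sumn_absz hbs; move: (\sum_(_ <- _) _) => S; lia.
rewrite size_map (iotaDl 1 0) -!map_comp; apply/eq_map => i /=.
rewrite add0n -map_drop sumn_absz ?opprK //.
by apply/allP => z /mem_drop; move/allP: hbs; apply.
Qed.

(** Nonnegativity of the new height is the inequality m <= q. As q entries precede the leftmost new
    m, this is the bound that an inversion sequence requires there. *)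
Lemma phi_step_facts (n : nat) (e : seq nat) (l : flabel) :
  (0 < n)%N -> IS102 n e -> valid_label (rank e) l ->
  let m := (maxe e + l.1)%N in
  let q := (fdes e - sumn (label_counts l))%N in
  [/\ phi_step e l = weave e m (fdes e) (label_counts l),
      (sumn (label_counts l) + m <= fdes e)%N, (0 < q)%N,
      (fdes e <= size e)%N & all (leq^~ (maxe e)) e].
Proof.
move=> n0 he /andP[hl hr] m q.
have [x [y [exy run ep em hm]]] := IS102_run n0 he.
have x0 : (0 < size x)%N by case/and3P: run; case: (x).
have hs := sumn_label_counts hl.
have hsm : (sumn (label_counts l) + m <= fdes e)%N.
  move: hr hs; rewrite /rank /label_incr /m.
  by move: (\sum_(_ <- _) _) => S; lia.
(* Entries are inserted after an existing entry, so q = 0 must be excluded. If m > 0, use m <= q; if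
   m = 0, then a = 0, so the label is (0;1) and q is [fdes e]. *)
have q0 : (0 < q)%N.
  have [m0|] := posnP m; last by rewrite /q; lia.
  rewrite /q /label_counts ifT; first by rewrite ep /= subn0.
  by case/orP: hl => // /and3P[]; move: m0; rewrite /m; lia.
have pe : (fdes e <= size e)%N by rewrite ep exy size_cat leq_addr.
split=> //; last by rewrite em.
by apply: phi_stepE => //; move: q0; rewrite /q; lia.
Qed.

Lemma phi_step_IS102 (n : nat) (e : seq nat) (l : flabel) :
  (0 < n)%N -> IS102 n e -> valid_label (rank e) l ->
  [/\ IS102 (n + size l.2) (phi_step e l),
      fdes (phi_step e l) = (fdes e - sumn (label_counts l)).+1 &
      maxe (phi_step e l) = (maxe e + l.1)%N].
Proof.
move=> n0 he hv; have [] := phi_step_facts n0 he hv.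
have [hl _] := andP hv.
set m := (maxe e + l.1)%N; set cs := label_counts l; set q := (_ - sumn cs)%N.
move=> -> hsm q0 pe hM.
have [x [y [exy run ep em _]]] := IS102_run n0 he.
have hm : all (leq^~ m) e by apply/sub_all: hM => z /leq_trans; apply; apply: leq_addr.
have hsz : size cs = size l.2 by apply: size_label_counts.
have [c [cs' ecs]] : exists c cs', cs = c :: cs'.
  have := label_size_gt0 hl; rewrite -hsz; case: (cs) => // c cs' _.
  by exists c, cs'.
have [Z [eW eW']] := weave_cons_eq m c cs' pe.
rewrite -ecs -/q in eW eW'.
have hw := all_weave cs pe hm.
have mW : m \in weave e m (fdes e) cs by rewrite eW mem_cat mem_head orbT.
have hmax := maxeP mW hw.
have qx : (q <= size x)%N by rewrite -ep leq_subr.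
have etq : take q e = take q x by rewrite exy takel_cat.
have x0 : (0 < size x)%N by case/and3P: run; case: (x).
have sx : sorted leq x by case/and3P: run.
have down_lt : ~~ up_label l -> (0 < l.1)%N /\ (0 < c)%N.
  move=> nu; case/orP: hl => [h|/and3P[h1]]; first by rewrite h in nu.
  move: ecs; rewrite /cs /label_counts (negbTE nu).
  by case: (l.2) => // b bs [<-].
(* The new first run ends at the leftmost new m. An up label is followed by the old descent bottom;
   a down label by an old entry, which is smaller than m because a >= 1. *)
have hrun : first_run (rcons (take q e) m) Z.
  apply/and3P; split; first by case: (take q e).
    rewrite (sorted_pairwise leq_trans) pairwise_rcons -(sorted_pairwise leq_trans).
    rewrite etq take_sorted // andbT -etq.
    by apply/allP => z /mem_take; move/allP: hm; apply.
  rewrite last_rcons; have [hu|nu] := boolP (up_label l).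
    have cs0 : cs = [:: 0%N] by rewrite /cs /label_counts hu.
    have ZE : Z = y.
      move: eW'; move: ecs; rewrite cs0 => -[_ <-] /=.
      rewrite /q cs0 /= subn0 ep exy take_size_cat // => /eqP.
      by rewrite eqseq_cat // eqxx => /eqP.
    rewrite ZE; case/and3P: run => _ _ /orP[->//|h]; apply/orP; right.
    by apply: leq_trans h _; rewrite -em leq_addr.
  have [a1 c1] := down_lt nu.
  have qp : (q < fdes e)%N by rewrite /q ltn_subrL ecs /= addn_gt0 c1 ep x0.
  have hZ : head 0%N Z = nth 0%N e q.
    have -> : head 0%N Z = nth 0%N (take q e ++ Z) q.
      by rewrite nth_cat size_takel ?ltnn ?subnn ?nth0 // (leq_trans (ltnW qp) pe).
    rewrite -eW' -(@nth_take q.+1) // take_weave ?nth_take //.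
    by move: hsm c1; rewrite /q ecs /=; clear; lia.
  apply/orP; right; rewrite hZ.
  have : (nth 0%N e q <= maxe e)%N.
    by move/allP: hM; apply; apply: mem_nth; apply: leq_trans qp pe.
  by move=> h; rewrite /m -addn1; apply: leq_add.
have eW2 : weave e m (fdes e) cs = rcons (take q e) m ++ Z by rewrite cat_rcons.
have sq : size (take q e) = q by rewrite size_takel // (leq_trans (leq_subr _ _) pe).
split=> //; last by rewrite eW2 fdes_first_run // size_rcons sq.
case: (he) => -[se hi] ha.
split; first split.
- by rewrite size_weave // se hsz.
- move=> i hin; rewrite eW; have [iq|qi] := ltnP i q.
    rewrite nth_cat sq iq nth_take //; apply: hi; rewrite -se.
    by apply: leq_trans pe; apply: leq_trans iq (leq_subr _ _).
  (* From index q on, the bound holds for every entry, since none exceeds m and m <= q. *)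
  have mq : (m <= q)%N by rewrite /q leq_subRL // (leq_trans _ hsm) ?leq_addr.
  apply: leq_trans (leq_trans mq qi); rewrite -eW.
  move/allP: hw; apply; apply: mem_nth.
  by rewrite size_weave // se hsz.
apply/(avoids102_max hw); rewrite drop_val_weave //.
have [a0|a0] := posnP l.1.
  have mM : m = maxe e by rewrite /m a0 addn0.
  have [h1 h2] := (avoids102_max hm).1 ha.
  split=> // w1 w2; have [hu|nu] := boolP (up_label l); last first.
    by have [] := down_lt nu; rewrite a0.
  have -> : weave e m (fdes e) cs = x ++ m :: y.
    rewrite /cs /label_counts hu /= subn0 ep exy take_size_cat //.
    by rewrite drop_size_cat.
  case/cat_cons_inv => [[w ex]|[w [-> ey]]]; last first.
    rewrite drop_val_cat drop_val_cons -drop_val_cat.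
    by apply: (h2 _ w2); rewrite exy ey catA.
  apply: (sorted_filter leq_trans).
  by move: sx; rewrite ex => /cat_sorted2[].
have me : m \notin e.
  apply/negP => /(allP hM); rewrite /m -[X in (_ <= X)%N]addn0 leq_add2l.
  by rewrite leqNgt a0.
(* At most [fdes e] old entries precede any m, so they form a prefix of the sorted run [x]. *)
rewrite drop_val_id //; split=> // w1 w2 ew.
have hsz1 : (size (drop_val m w1) <= size x)%N.
  by rewrite -ep (weave_prefix pe me ew).
have : drop_val m w1 = take (size (drop_val m w1)) x.
  rewrite -(takel_cat y hsz1) -exy.
  rewrite -[X in take _ X](drop_val_id me) -(drop_val_weave m cs pe) ew drop_val_cat.
  by rewrite take_size_cat.
by move->; apply: take_sorted.
Qed.

Lemma up_label0 (l : flabel) :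
  up_label l || down_label l -> l.1 = 0%N -> l = (0%N, [:: 1]).
Proof.
by case: l => a bs /= + a0; rewrite a0 => /orP[/eqP /= ->|/and3P[]].
Qed.

Lemma new_max_notin (n : nat) (e : seq nat) (l : flabel) :
  (0 < n)%N -> IS102 n e -> valid_label (rank e) l ->
  (0 < l.1)%N -> (maxe e + l.1)%N \notin e.
Proof.
move=> n0 he hv l1; have [_ _ _ _ /allP hM] := phi_step_facts n0 he hv.
by apply/negP => /hM; rewrite -[X in (_ <= X)%N]addn0 leq_add2l leqNgt l1.
Qed.

(** Recovers from the image whether a = 0. The zero-based index [.-2] points to the entry just
    before the end of the first run; it is an old entry, hence smaller than m when a > 0. *)
Lemma phi_step_repeats_max (n : nat) (e : seq nat) (l : flabel) :
  (0 < n)%N -> IS102 n e -> valid_label (rank e) l ->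
  let e' := phi_step e l in
  (nth 0%N e' (fdes e').-2 == maxe e') = (l.1 == 0%N).
Proof.
move=> n0 he hv e'.
have [_ ef em] := phi_step_IS102 n0 he hv.
have [eW hsm q0 pe /allP hM] := phi_step_facts n0 he hv.
rewrite /e' ef em eW /=.
set q := (fdes e - _)%N in q0 *.
have hq : (q.-1 < q)%N by rewrite prednK.
have qe : (q <= fdes e)%N by apply: leq_subr.
rewrite -(nth_take _ hq) take_weave // nth_take //.
have : (nth 0%N e q.-1 <= maxe e)%N.
  by apply/hM/mem_nth/(leq_trans hq)/(leq_trans qe).
have [a0|a0 hle] := posnP l.1; last by rewrite ltn_eqF //; lia.
have [hl _] := andP hv.
have -> : q = fdes e by rewrite /q (up_label0 hl a0) subn0.
rewrite a0 addn0 => _.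
have [x [y [-> run ep -> _]]] := IS102_run n0 he.
case/and3P: run => x0 _ _; rewrite ep nth_cat prednK ?leqnn ?lt0n ?size_eq0 //.
by rewrite nth_last eqxx.
Qed.

Lemma phi_step_inj (n : nat) (e : seq nat) (l : flabel) (n' : nat)
    (e' : seq nat) (l' : flabel) :
  (0 < n)%N -> (0 < n')%N -> IS102 n e -> IS102 n' e' ->
  valid_label (rank e) l -> valid_label (rank e') l' ->
  phi_step e l = phi_step e' l' -> e = e' /\ l = l'.
Proof.
move=> n0 n0' he he' hv hv' ee.
have [[hl _] [hl' _]] := (andP hv, andP hv').
have [_ ef em] := phi_step_IS102 n0 he hv.
have [_ ef' em'] := phi_step_IS102 n0' he' hv'.
have [eW hsm q0 pe hM] := phi_step_facts n0 he hv.
have [eW' hsm' q0' pe' hM'] := phi_step_facts n0' he' hv'.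
have eqa : (l.1 == 0%N) = (l'.1 == 0%N).
  rewrite -(phi_step_repeats_max n0 he hv) -(phi_step_repeats_max n0' he' hv').
  by rewrite ee.
have emm : (maxe e + l.1 = maxe e' + l'.1)%N by rewrite -em ee em'.
have eqq : (fdes e - sumn (label_counts l) = fdes e' - sumn (label_counts l'))%N.
  by have := ef; rewrite ee ef' => -[].
have [a0|a0] := posnP l.1.
  have a0' : l'.1 = 0%N by apply/eqP; rewrite -eqa a0.
  have el := up_label0 hl a0; have el' := up_label0 hl' a0'.
  split; last by rewrite el el'.
  move: eqq pe pe'; rewrite el el' /label_counts /= !subn0 => eqq pe pe'.
  move: ee; rewrite eW eW' el el' /label_counts /= !subn0 -eqq in pe' *.
  move=> /eqP; rewrite eqseq_cat ?size_takel // eqseq_cons => /and3P[/eqP e1 _ /eqP e2].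
  by rewrite -(cat_take_drop (fdes e) e) e1 e2 cat_take_drop.
have a0' : (0 < l'.1)%N by rewrite lt0n -eqa -lt0n.
have me := new_max_notin n0 he hv a0.
have me' := new_max_notin n0' he' hv' a0'.
have eqe : e = e'.
  rewrite -(drop_val_id me) -(drop_val_weave _ (label_counts l) pe) -eW ee eW'.
  by rewrite emm drop_val_weave // drop_val_id.
split=> //; subst e'.
have a1 : l.1 = l'.1 by apply/eqP; rewrite -(eqn_add2l (maxe e)) emm.
have ecs : label_counts l = label_counts l'.
  apply: (@weave_inj e (maxe e + l.1) (fdes e)) => //.
  - by apply: leq_trans hsm; apply: leq_addr.
  - by apply: leq_trans hsm'; apply: leq_addr.
  - by rewrite -eW ee eW' emm.
move: hl hl' a1 ecs; clear; case: l l' => [a bs] [a' bs'] hl hl' /= a1; subst a' => ecs.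
by rewrite (label_counts_inj hl hl' ecs).
Qed.

(** Deletion moves entries to the left, but only beyond the prefix [x]. Every index there is at
    least [size x], which is at least m because m itself stands at that index in [e]. *)
Lemma IS102_subseq (n : nat) (e e' x z : seq nat) (m : nat) :
  IS102 n e -> e = x ++ m :: z -> all (leq^~ m) e ->
  subseq e' e -> prefix x e' -> IS102 (size e') e'.
Proof.
move=> [[se hi] /avoids102P ha] ex hm hs /prefixP[z' ex'].
have mx : (m <= size x)%N.
  have := hi (size x); rewrite -se ex nth_cat ltnn subnn /=; apply.
  by rewrite size_cat /= addnS ltnS leq_addr.
split; last first.
  apply/avoids102P => a b c ba ac; apply: contra (ha _ _ _ ba ac) => h.
  exact: subseq_trans h hs.
split=> // i ie; have [ix|xi] := ltnP i (size x).
  rewrite ex' nth_cat ix; have := hi i; rewrite -se ex nth_cat ix; apply.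
  by rewrite size_cat; apply: leq_trans ix (leq_addr _ _).
apply: leq_trans (leq_trans mx xi).
by move/allP: hm; apply; apply: (mem_subseq hs); apply: mem_nth.
Qed.

Lemma sorted_prefix_first_run (x y w w' : seq nat) :
  first_run x y -> x ++ y = w ++ w' -> sorted leq w -> (size w <= size x)%N.
Proof.
case/and3P => x0 _ hy e sw; rewrite leqNgt; apply/negP => lt.
have ex : x = take (size x) w.
  by have := congr1 (take (size x)) e; rewrite take_size_cat // takel_cat // ltnW.
have ew : w = x ++ drop (size x) w by rewrite {1}ex cat_take_drop.
have ey : y = drop (size x) w ++ w'.
  by have := congr1 (drop (size x)) e; rewrite drop_size_cat // drop_cat lt.
move: ew ey sw; case ed: (drop (size x) w) => [|c v].
  by have := congr1 size ed; rewrite size_drop /=; lia.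
move=> -> ey; rewrite {}ey /= in hy; clear e lt ex ed.
case: x x0 hy => //= a x _ hc.
by rewrite cat_path /= leqNgt hc andbF.
Qed.

Lemma phi_step_surj (n : nat) (E : seq nat) : (0 < n)%N -> IS102 n E ->
  (n = 1%N /\ E = [:: 0%N]) \/
  exists n' e l, [/\ (0 < n')%N, IS102 n' e, valid_label (rank e) l,
                     E = phi_step e l & n = (n' + size l.2)%N].
Proof.
move=> n0 hE; have [x [y [exy run ep em hm]]] := IS102_run n0 hE.
have [[sE hi] ha] := hE.
case/and3P: (run); case/lastP: x exy run ep em hm => // x m exy run ep em hm _ sx hy.
rewrite last_rcons in em hm hy; rewrite cat_rcons in exy.
have mx : (m <= size x)%N.
  have := hi (size x); rewrite -sE exy nth_cat ltnn subnn /=; apply.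
  by rewrite size_cat /= addnS ltnS leq_addr.
have [x0|x0] := posnP (size x).
  left; move: mx; rewrite x0 leqn0 => /eqP m0.
  rewrite m0 in hy exy; rewrite (size0nil x0) in exy.
  by case: y hy exy {run} => //= _ eE; rewrite -sE eE.
have sx' : sorted leq x by move: sx; rewrite -cats1 => /cat_sorted2[].
have hxm : all (leq^~ m) x by move: hm; rewrite exy all_cat => /andP[].
have xn : x != [::] by rewrite -size_eq0 -lt0n.
(* If m stands twice, removing one copy leaves the maximum unchanged, so the last label was
   (0;1). *)
right; have [elm|nlm] := eqVneq (last 0%N x) m.
  have run' : first_run x y by rewrite /first_run xn sx' elm.
  have he : IS102 (size (x ++ y)) (x ++ y).
    apply: (IS102_subseq hE exy hm); last exact: prefix_prefix.
    by rewrite exy; apply: cat_subseq (subseq_refl _) (subseq_cons _ _).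
  have s0 : (0 < size (x ++ y))%N by rewrite size_cat ltn_addr.
  have fe := fdes_first_run run'.
  have me : maxe (x ++ y) = m.
    apply: maxeP; last by move: hm; rewrite exy !all_cat /= => /and3P[-> _ ->].
    by rewrite mem_cat -elm; case: (x) xn => //= a v _; rewrite mem_last.
  exists (size (x ++ y)), (x ++ y), (0%N, [:: 1]); split=> //.
  - by rewrite /valid_label /= /rank fe me /label_incr /= big_seq1; lia.
  - rewrite phi_stepE //= fe ?me /label_counts /= ?size_cat ?leq_addr //.
    by rewrite subn0 take_size_cat // drop_size_cat // addn0.
  - by rewrite -sE exy !size_cat /= addnS addn1.
have xm : m \notin x.
  apply/negP => mx'; have : (m <= last 0%N x)%N.
    case/lastP: x xn sx' mx' {nlm exy run ep mx x0 hxm sx} => // x c _.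
    rewrite (sorted_pairwise leq_trans) pairwise_rcons => /andP[/allP hc _].
    by rewrite mem_rcons inE last_rcons => /predU1P[->//|/hc].
  have : (last 0%N x <= m)%N.
    by move/allP: hxm; apply; case: (x) xn => //= a v _; rewrite mem_last.
  by move: nlm; lia.
pose e := drop_val m E.
have ee : e = x ++ drop_val m y.
  by rewrite /e exy drop_val_cat drop_val_cons drop_val_id.
have he : IS102 (size e) e.
  apply: (IS102_subseq hE exy hm); first exact: filter_subseq.
  by rewrite ee prefix_prefix.
have s0 : (0 < size e)%N by rewrite ee size_cat ltn_addr.
have [u [v [euv run' fe me _]]] := IS102_run s0 he.
have [_ hmax] := (avoids102_max hm).1 ha.
have pe : (fdes e <= size (drop_val m E))%N by rewrite -/e fe euv size_cat leq_addr.
(* The entries other than m before a given m are sorted and form a prefix of [e], so they fit into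
   its first run. *)
have [|cs [hs eW]] := weave_surj pe.
  move=> w1 w2 eE; rewrite fe; apply: (sorted_prefix_first_run run' (w' := drop_val m w2)).
    by rewrite -euv /e eE drop_val_cat drop_val_cons.
  exact: hmax eE.
have ne : m \notin e := drop_val_notin m E.
rewrite -/e in pe eW.
case: cs hs eW => [|c cs] hs eW.
  by move: ne; rewrite -(eW : E = e) exy mem_cat mem_head orbT.
have [W [eW1 eW2]] := weave_cons_eq m c cs pe.
have eq : (fdes e - sumn (c :: cs))%N = size x.
  have ntq : m \notin take (fdes e - sumn (c :: cs)) e by apply: contra ne; apply: mem_take.
  have := congr1 (index m) eW; rewrite eW1 {1}exy !index_cat (negbTE ntq) (negbTE xm).
  rewrite /= eqxx !addn0 size_takel; first by move->.
  exact: leq_trans (leq_subr _ _) pe.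
(* A first count of 0 followed by another count would put two copies of m side by side at the end of
   the first run, so [y] would start with m instead of a smaller entry. *)
have c0 : c = 0%N -> cs = [::].
  case: cs eW2 eW1 eq hs eW => // c2 cs eW2 eW1 eq hs eW c0.
  have := eW; rewrite exy eW1 eq => /eqP.
  rewrite eqseq_cat; last by rewrite size_takel // -eq (leq_trans (leq_subr _ _) pe).
  case/andP => /eqP ex; rewrite eqseq_cons eqxx /= => /eqP eyW.
  have := eW2; rewrite weave_cons eq.
  have -> : (fdes e - sumn (c2 :: cs))%N = size x by rewrite -eq c0.
  move=> /eqP; rewrite eqseq_cat // eqxx /= => /eqP eWm.
  by move: hy; rewrite eyW -eWm /= ltnn.
have ltm : (maxe e < m)%N.
  rewrite me ltn_neqAle; have hin : last 0%N u \in e.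
    rewrite euv mem_cat; case/and3P: run' => + _ _.
    by case: (u) => //= a w _; rewrite mem_last.
  apply/andP; split; first by apply: contraNneq ne => <-.
  by move/allP: hm; apply; apply: mem_subseq hin; apply: filter_subseq.
(* This inverts [label_counts], whose first count is 1 - b_1. *)
pose bs : seq int := if c == 0%N then [:: 1] else - (c.-1)%:Z :: [seq - t%:Z | t <- cs].
pose l : flabel := ((m - maxe e)%N, bs).
have hbs : up_label l || down_label l.
  rewrite /l /bs; case: (posnP c) => [_|cp]; first by [].
  apply/orP; right; rewrite /down_label /= subn_gt0 ltm oppr_le0 /=.
  by apply/allP => _ /mapP[t _ ->]; rewrite oppr_le0.
have lcs : label_counts l = c :: cs.
  rewrite /label_counts /l /up_label /bs /=; case: (posnP c) => [z|cp].
    by rewrite z c0.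
  rewrite ifN; last by rewrite eqseq_cons negb_and; case: (c.-1).
  congr cons; first by rewrite abszN prednK.
  by rewrite -map_comp -[RHS]map_id; apply/eq_map => t; rewrite /= abszN.
have mE : (maxe e + l.1 = m)%N by rewrite /= subnKC // ltnW.
exists (size e), e, l; split=> //.
- rewrite /valid_label hbs /=; have := sumn_label_counts hbs.
  rewrite lcs /rank /label_incr; move: (\sum_(_ <- _) _) => S.
  by move: eq mx ltm hs; rewrite /l; move: (sumn _) => s /=; clear; lia.
- by rewrite phi_stepE // lcs ?mE // -subn_gt0 eq.
- by rewrite -(size_label_counts hbs) lcs -sE {1}eW size_weave.
Qed.

Lemma phi_bij :
  (forall n, set_bij (LF n) (IS102 n.+1) phi) /\
  (forall n Q, LF n Q -> rank (phi Q) = height Q).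
Proof.
apply: (@bij_from_steps _ [:: 0%N] phi_step phi IS102 rank) => //.
- by move=> Q l _; rewrite phi_rcons.
- split; first by split=> // -[].
  by move=> [|i] [|j] [|k].
- by rewrite /rank /maxe big_seq1.
- move=> n e l n0 he hv; have [h1 h2 h3] := phi_step_IS102 n0 he hv.
  split=> //; rewrite /rank h2 h3.
  have [hl _] := andP hv.
  have [_ hsm _ _ _] := phi_step_facts n0 he hv.
  have := sumn_label_counts hl; rewrite /label_incr.
  by move: (\sum_(_ <- _) _) hsm => S; clear; lia.
- exact: phi_step_inj.
- exact: phi_step_surj.
Qed.

(** * The map psi *)

Definition rise (s : ustep) : int := (uvec s).2.

Definition ht (w : seq ustep) : int := \sum_(s <- w) rise s.

Definition width (w : seq ustep) : int := \sum_(s <- w) (uvec s).1.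

(** The starting height is a parameter, here and in [nret], so that both split over
    concatenation. *)
Fixpoint stays (h : int) (w : seq ustep) : bool :=
  (0 <= h) && (if w is s :: w' then stays (h + rise s) w' else true).

Fixpoint nret (h : int) (w : seq ustep) : nat :=
  if w is s :: w' then
    (((s == DStep) && (h + rise s == 0)%R) + nret (h + rise s)%R w')%N
  else 0%N.

Definition compat (s t : ustep) : bool :=
  match s, t with
  | UStep, VStep | VStep, UStep => false
  | _, _ => true
  end.

Arguments compat !s !t.

Definition good (w : seq ustep) : bool := sorted compat w.

Arguments good w : simpl never.

(* The default [DStep] makes the empty path qualify, and it is compatible with
   every step, so that no case distinction is needed at the ends of words. *)
Definition arch (w : seq ustep) : bool :=
  [&& stays 0 w, ht w == 0, good w & last DStep w == DStep].

Lemma ht_nil : ht [::] = 0. Proof. exact: big_nil. Qed.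
Lemma ht_cons s w : ht (s :: w) = rise s + ht w. Proof. exact: big_cons. Qed.
Lemma ht_cat w1 w2 : ht (w1 ++ w2) = ht w1 + ht w2. Proof. exact: big_cat. Qed.
Lemma ht_nseqV k : ht (nseq k VStep) = - (2 * k)%N%:Z.
Proof. by elim: k => [|k IH]; rewrite ?ht_nil // [nseq _ _]/= ht_cons IH /rise /=; lia. Qed.
Definition htE := (ht_cat, ht_cons, ht_nil, ht_nseqV).

Lemma width_nil : width [::] = 0. Proof. exact: big_nil. Qed.
Lemma width_cons s w : width (s :: w) = (uvec s).1 + width w.
Proof. exact: big_cons. Qed.
Lemma width_cat w1 w2 : width (w1 ++ w2) = width w1 + width w2.
Proof. exact: big_cat. Qed.
Lemma width_nseqV k : width (nseq k VStep) = 0.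
Proof. by elim: k => [|k IH]; rewrite ?width_nil // [nseq _ _]/= width_cons IH. Qed.
Definition widthE := (width_cat, width_cons, width_nil, width_nseqV).

Lemma width_ge0 w : 0 <= width w.
Proof. by apply: sumr_ge0 => -[]. Qed.

Lemma stays_start h w : stays h w -> 0 <= h.
Proof. by case: w => [|s w] /= /andP[]. Qed.

Lemma stays_cat h w1 w2 : stays h (w1 ++ w2) = stays h w1 && stays (h + ht w1) w2.
Proof.
elim: w1 h => [|s w1 IH] h /=; last by rewrite IH ht_cons addrA andbA.
rewrite ht_nil addr0 andbT; case E: (stays h w2); last by rewrite andbF.
by rewrite (stays_start E).
Qed.

Lemma stays_le h h' w : stays h w -> h <= h' -> stays h' w.
Proof.
elim: w h h' => [|s w IH] h h' /= /andP[h0 hw] hh.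
  by rewrite (le_trans h0 hh).
by rewrite (le_trans h0 hh) (IH _ _ hw) // lerD2r.
Qed.

Lemma stays_end h w : stays h w -> 0 <= h + ht w.
Proof. by rewrite -[X in stays h X]cats0 stays_cat => /andP[_ /stays_start]. Qed.

Lemma stays_nseqV h k : stays h (nseq k VStep) = ((2 * k)%N%:Z <= h).
Proof.
elim: k h => [|k IH] h /=; first by rewrite andbT.
by rewrite IH /rise /=; lia.
Qed.

Lemma nret_cat h w1 w2 : nret h (w1 ++ w2) = (nret h w1 + nret (h + ht w1)%R w2)%N.
Proof.
elim: w1 h => [|s w1 IH] h /=; first by rewrite ht_nil addr0.
by rewrite IH ht_cons addrA addnA.
Qed.

Lemma nret_high h w : stays h w -> nret (h + 1) w = 0%N.
Proof.
elim: w h => [|s w IH] h //= /andP[_ hw].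
rewrite addrAC (IH _ hw) addn0; have := stays_start hw.
by case: (s == _) => //=; case: eqP => //; lia.
Qed.

Lemma good_cat w1 w2 : good (w1 ++ w2) =
  [&& good w1, good w2 & compat (last DStep w1) (head DStep w2)].
Proof.
rewrite /good; case: w1 => [|s w1] /=; first by rewrite andbT.
rewrite cat_path; case: w2 => [|t w2] /=; first by case: (last s w1); rewrite ?andbT.
by rewrite [compat _ _ && _]andbC.
Qed.

Lemma good_cons s w : good (s :: w) = compat s (head DStep w) && good w.
Proof. by rewrite -cat1s good_cat /= andbC. Qed.

Lemma good_nseqV k : good (nseq k VStep ++ [:: DStep]).
Proof.
elim: k => // k IH; rewrite [nseq _ _]/= cat_cons good_cons IH andbT.
by case: k {IH}.
Qed.

Lemma goodE S : good S =
  ~~ infix [:: UStep; VStep] S && ~~ infix [:: VStep; UStep] S.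
Proof.
elim: S => [|s S IH] //; rewrite !infix_consl.
rewrite good_cons IH; case: S {IH} => [|t S]; first by rewrite !infixs0; case: s.
by case: s; case: t; rewrite /= ?prefix0s /= ?andbF.
Qed.

Lemma stays_head h w : h <= 1 -> stays h w -> head DStep w != VStep.
Proof.
by case: w => [|[] w] //= h1 /andP[_ /stays_start]; rewrite /rise /=; lia.
Qed.

Lemma stays_last w : stays 0 w -> ht w = 0 -> last DStep w != UStep.
Proof.
case/lastP: w => // w s; rewrite last_rcons -cats1 stays_cat !htE => /andP[].
by move/stays_end; case: s => //; rewrite /rise /=; lia.
Qed.

Lemma compat_not_V s t : s != VStep -> t != VStep -> compat s t.
Proof. by case: s; case: t. Qed.

Lemma archP w : arch w ->
  [/\ stays 0 w, ht w = 0, good w & last DStep w = DStep].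
Proof. by case/and4P => ? /eqP ? ? /eqP. Qed.

Lemma arch_cat w1 w2 : arch w1 -> arch w2 -> arch (w1 ++ w2).
Proof.
case/archP => a1 a2 a3 a4 /archP[b1 b2 b3 b4]; apply/and4P; split.
- by rewrite stays_cat a1 a2 add0r.
- by rewrite !htE a2 b2.
- by rewrite good_cat a3 b3 a4.
- by rewrite last_cat a4 b4.
Qed.

Lemma arch_flatten ws : all arch ws -> arch (flatten ws).
Proof.
elim: ws => [|w ws IH] /=; first by rewrite /arch ht_nil.
by case/andP => hw /IH; apply: arch_cat.
Qed.

(* A path touching the axis by a v step could only continue with u, which is
   forbidden after v. *)
Lemma arch_cat_split w1 w2 : arch (w1 ++ w2) -> ht w1 = 0 -> arch w1 /\ arch w2.
Proof.
case/archP; rewrite stays_cat good_cat last_cat !htE => /andP[a1 a2] hh.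
case/and3P => g1 g2 g12 hl h1; rewrite h1 !add0r in hh a2.
have l1 : last DStep w1 = DStep.
  have := stays_last a1 h1; move: g12 hl.
  case: (last DStep w1) => //; case: w2 a2 {hh g2} => [|[] w2] //=.
    by move/stays_start.
  by move/stays_start.
by rewrite l1 in hl; rewrite /arch a1 h1 g1 l1 a2 hh g2 hl.
Qed.

Lemma nret_arch_gt0 w : arch w -> w != [::] -> (0 < nret 0 w)%N.
Proof.
case/archP => _ + _ +; case/lastP: w => // w s; rewrite last_rcons -cats1 nret_cat !htE.
by move=> + es _; rewrite {}es add0r addr0 /= => ->; rewrite addnS.
Qed.

Lemma nret_cat_arch w1 w2 : arch w1 -> nret 0 (w1 ++ w2) = (nret 0 w1 + nret 0 w2)%N.
Proof. by case/archP => _ h _ _; rewrite nret_cat h addr0. Qed.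

Lemma nret_flatten ws : all arch ws ->
  nret 0 (flatten ws) = sumn (map (nret 0) ws).
Proof. by elim: ws => [|w ws IH] //= /andP[hw /IH <-]; rewrite nret_cat_arch. Qed.

(** The cut comes right after the c-th return. The induction needs an arbitrary starting height, so
    for c = 0 only the empty prefix is claimed, not height 0. *)
Lemma nret_split h S c : (c <= nret h S)%N -> exists w1 w2,
  [/\ S = w1 ++ w2, nret h w1 = c, c = 0%N -> w1 = [::] &
      (0 < c)%N -> h + ht w1 = 0].
Proof.
elim: S h c => [|s S IH] h c /=.
  by rewrite leqn0 => /eqP->; exists [::], [::].
case: (posnP c) => [->|c0 hc]; first by exists [::], (s :: S).
case eb: ((s == DStep) && _) hc => /= hc; last first.
  have [w1 [w2 [-> e1 _ e3]]] := IH _ _ hc.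
  exists (s :: w1), w2; split=> //=; first by rewrite eb e1.
  - by move=> z; rewrite z in c0.
  - by move=> _; rewrite ht_cons addrA e3.
have hc1 : (c.-1 <= nret (h + rise s) S)%N by rewrite -ltnS prednK.
have [w1 [w2 [-> e1 e2 e3]]] := IH _ _ hc1.
exists (s :: w1), w2; split=> //=; first by rewrite eb e1 add1n prednK.
- by move=> z; rewrite z in c0.
- move=> _; rewrite ht_cons addrA; case: (posnP c.-1) => [/e2 ->|/e3 //].
  by case/andP: eb => _ /eqP ->; rewrite ht_nil.
Qed.

Lemma arch_nret_split S c : arch S -> (c <= nret 0 S)%N -> exists w1 w2,
  [/\ S = w1 ++ w2, arch w1, arch w2, nret 0 w1 = c & nret 0 S = (c + nret 0 w2)%N].
Proof.
move=> aS /nret_split[w1 [w2 [eS e1 e2 e3]]].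
have h1 : ht w1 = 0.
  by case: (posnP c) => [/e2 ->|/e3]; rewrite ?ht_nil ?add0r.
move: aS; rewrite eS => /arch_cat_split/(_ h1)[a1 a2].
by exists w1, w2; split=> //; rewrite nret_cat_arch // e1.
Qed.

Lemma arch_nret_flatten S ns : arch S -> nret 0 S = sumn ns -> exists ws,
  [/\ S = flatten ws, all arch ws & map (nret 0) ws = ns].
Proof.
elim: ns S => [|c ns IH] S aS hS.
  exists [::]; split=> //; case: (eqVneq S [::]) => // /(nret_arch_gt0 aS).
  by rewrite hS.
have [|w1 [w2 [eS a1 a2 e1 e2]]] := @arch_nret_split S c aS.
  by rewrite hS /= leq_addr.
have [|ws [ews aws mws]] := IH w2 a2.
  by apply/eqP; rewrite -(eqn_add2l c) -e2 hS.
by exists (w1 :: ws); rewrite /= eS ews aws a1 e1 mws.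
Qed.

Lemma rcons_nseq (T : Type) (x : T) n : rcons (nseq n x) x = nseq n.+1 x.
Proof. by rewrite -cats1 -addn1 nseqD. Qed.

Lemma trailing_V w : exists A r, w = A ++ nseq r VStep /\ last DStep A != VStep.
Proof.
elim/last_ind: w => [|w s [A [r [-> hA]]]]; first by exists [::], 0%N.
case: (eqVneq s VStep) => [->|hs].
  by exists A, r.+1; rewrite rcons_cat rcons_nseq.
by exists (rcons (A ++ nseq r VStep) s), 0%N; rewrite cats0 last_rcons.
Qed.

(** * Shapes of the words before and after a step of psi *)

Definition up_form (A B : seq ustep) : seq ustep := A ++ UStep :: B ++ [:: DStep].

Definition lifted (ws : seq (seq ustep)) : seq ustep :=
  flatten [seq UStep :: w ++ [:: UStep] | w <- ws].

Definition first_part (A : seq ustep) (r : nat) : seq ustep :=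
  A ++ nseq r VStep ++ [:: DStep].

(* The decomposition [alpha v^r d sigma_1 ... sigma_k tau] on which case (2) of
   psi operates. *)
Definition down_split (A : seq ustep) (r : nat) (ws : seq (seq ustep))
    (T : seq ustep) : bool :=
  [&& arch (first_part A r), last DStep A != VStep, all arch ws, arch T,
      T != [::] & ws != [::]].

Definition down_source (A : seq ustep) (r : nat) (ws : seq (seq ustep))
    (T : seq ustep) : seq ustep :=
  first_part A r ++ flatten ws ++ T.

(** As beta = v^r d, the suffix v^k beta is a single run of k + r steps v followed by d. *)
Definition down_form (A : seq ustep) (r : nat) (ws : seq (seq ustep))
    (T : seq ustep) : seq ustep :=
  A ++ lifted ws ++ T ++ nseq (size ws + r) VStep ++ [:: DStep].

Lemma arch_up_form A B : arch A -> arch B -> arch (up_form A B).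
Proof.
case/archP => a1 a2 a3 a4 /archP[b1 b2 b3 b4]; apply/and4P; split.
- rewrite !(stays_cat, htE) a1 a2 /= !(stays_cat, htE) b2 (stays_le b1) //=.
- by rewrite !htE a2 b2.
- rewrite good_cat a3 a4 good_cons good_cat b3 b4 /= !andbT.
  by apply: compat_not_V => //; case: (B) b1 => //= s w; apply: (@stays_head 0 (s :: w)).
- by rewrite /up_form !(last_cat, last_cons).
Qed.

Lemma nret_up_form A B : arch A -> arch B -> nret 0 (up_form A B) = (nret 0 A).+1.
Proof.
move=> aA /archP[b1 b2 _ _]; rewrite nret_cat_arch //= addrC.
by rewrite nret_cat b2 (nret_high b1) /= addn1.
Qed.

Lemma width_up_form A B : width (up_form A B) = width (A ++ B) + 2.
Proof. by rewrite /up_form !widthE /=; lia. Qed.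

Lemma ht_lifted ws : all arch ws -> ht (lifted ws) = (2 * size ws)%N%:Z.
Proof.
elim: ws => [|w ws IH] /=; first by rewrite ht_nil.
case/andP => /archP[_ hw _ _] /IH e; rewrite /lifted /= -/(lifted ws).
by rewrite !htE e hw /rise /=; lia.
Qed.

Lemma width_lifted ws : width (lifted ws) = width (flatten ws) + (2 * size ws)%N%:Z.
Proof.
elim: ws => [|w ws IH] /=; first by rewrite width_nil.
by rewrite /lifted /= -/(lifted ws) !widthE IH /=; lia.
Qed.

Lemma stays_lifted h ws : 0 <= h -> all arch ws -> stays h (lifted ws).
Proof.
elim: ws h => [|w ws IH] h h0 /=; first by rewrite h0.
case/andP => /archP[hw ew _ _] aws.
rewrite h0 /= -cat_rcons -cats1 -/(lifted ws) -!catA !stays_cat !htE ew.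
rewrite (stays_le hw) /=; last by rewrite /rise /=; lia.
by rewrite IH // /rise /= ?andbT; lia.
Qed.

Lemma good_lifted ws : all arch ws -> good (lifted ws).
Proof.
elim: ws => [|w ws IH] //= /andP[/archP[w1 w2 w3 w4] /IH e].
rewrite /lifted /= -/(lifted ws) good_cons !good_cat w3 w4 e /= last_cat /=.
rewrite compat_not_V //; last first.
  by case: (w) w1 => //= s w'; apply: (@stays_head 0 (s :: w')).
by rewrite compat_not_V //; case: (ws).
Qed.

Lemma ht_first_part A r : arch (first_part A r) -> ht A = (2 * r).+1%:Z.
Proof. by case/archP => _; rewrite !htE /rise /=; lia. Qed.

Lemma last_first_part A r : arch (first_part A r) -> last DStep A != VStep ->
  (0 < r)%N -> last DStep A = DStep.
Proof.
case/archP => _ _ + _; rewrite /first_part good_cat => /and3P[_ _].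
by case: r => // r; case: (last DStep A).
Qed.

Lemma lifted_rcons ws w : lifted (rcons ws w) = lifted ws ++ UStep :: w ++ [:: UStep].
Proof. by rewrite /lifted map_rcons flatten_rcons. Qed.

(** The true starting height is 2r + 1. The spare unit shows that this stretch avoids the axis
    altogether, so it stays nonnegative and, by [nret_high], adds no return. *)
Lemma stays_after_first_part A r ws T : down_split A r ws T ->
  stays (2 * r)%N (lifted ws ++ T ++ nseq (size ws + r) VStep).
Proof.
case/and5P => _ _ aws /archP[t1 t2 _ _] _.
rewrite !stays_cat stays_lifted // ht_lifted // stays_nseqV t2 (stays_le t1) //=; lia.
Qed.

Lemma arch_down_form A r ws T : down_split A r ws T -> arch (down_form A r ws T).
Proof.
move=> ds; have sb := stays_after_first_part ds.
case/and5P: (ds) => aA lA aws /archP[t1 t2 t3 t4] /andP[Tn wsn].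
have hA := ht_first_part aA.
case/archP: (aA) => a1 a2 a3 a4.
have hB := ht_lifted aws.
apply/and4P; split.
- rewrite /down_form stays_cat.
  move: a1; rewrite /first_part stays_cat => /andP[-> _]; rewrite hA add0r.
  rewrite !catA stays_cat -!catA (stays_le sb) /=; last by clear; lia.
  by rewrite !htE hB t2 /rise /=; clear; lia.
- by rewrite !htE hA hB t2 /rise /=; clear; lia.
- move: a3; rewrite /first_part good_cat => /and3P[gA _ _].
  rewrite /down_form good_cat gA good_cat good_lifted // good_cat t3 good_nseqV t4 /=.
  have hT : head DStep T != VStep by apply: stays_head t1.
  apply/andP; split.
    apply: compat_not_V; last by case: (T) Tn hT.
    by case/lastP: (ws) => // ws' w; rewrite lifted_rcons last_cat /= last_cat.
  by apply: compat_not_V => //; case: (ws) wsn.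
- by rewrite /down_form !last_cat.
Qed.

Lemma nret_first_part A r : arch (first_part A r) ->
  nret 0 (first_part A r) = (nret 0 A).+1.
Proof.
move=> aA; have hA := ht_first_part aA.
rewrite /first_part nret_cat hA add0r nret_cat htE.
have -> : (2 * r).+1%:Z = (2 * r)%N%:Z + 1 by lia.
rewrite nret_high ?stays_nseqV //= /rise /= add0n addn0.
by rewrite (_ : _ == 0) ?addn1 //; apply/eqP; lia.
Qed.

Lemma nret_down_form A r ws T : down_split A r ws T ->
  nret 0 (down_form A r ws T) = nret 0 (first_part A r).
Proof.
move=> ds; have sb := stays_after_first_part ds.
case/and5P: (ds) => aA lA aws /archP[t1 t2 t3 t4] /andP[Tn wsn].
rewrite nret_first_part // /down_form nret_cat (ht_first_part aA) add0r.
have -> : (2 * r).+1%:Z = (2 * r)%N%:Z + 1 by lia.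
rewrite !catA nret_cat -catA nret_high // !htE ht_lifted // t2 /= addn0.
by rewrite (_ : _ == 0) ?addn1 // /rise /=; apply/eqP; lia.
Qed.

Lemma width_down_form A r ws T :
  width (down_form A r ws T) = width (down_source A r ws T) + (2 * size ws)%N%:Z.
Proof. by rewrite /down_form /down_source /first_part !widthE width_lifted /=; lia. Qed.

(** If one cut lay strictly before the other, the word between its u and the second cut would have
    height -1 and be a prefix of a word that stays nonnegative. *)
Lemma last_passage_uniq A B A' B' : A ++ UStep :: B = A' ++ UStep :: B' ->
  ht A = ht A' -> stays 0 B -> stays 0 B' -> A = A' /\ B = B'.
Proof.
have aux X Y X' Y' : X ++ UStep :: Y = X' ++ UStep :: Y' ->
    ht X = ht X' -> stays 0 Y -> exists w, X = X' ++ w.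
  case/cat_cons_inv => [//|[w [-> eY]]]; rewrite eY !htE stays_cat => h.
  by case/andP => /stays_end; move: h; rewrite /rise /=; lia.
move=> e h hB hB'; have [w eA] := aux _ _ _ _ e h hB.
have [w' eA'] := aux _ _ _ _ (esym e) (esym h) hB'.
have w0 : size w = 0%N.
  have := congr1 size eA; rewrite eA' !size_cat; lia.
move/size0nil: w0 => w0; rewrite w0 cats0 in eA; split=> //.
by move/eqP: e; rewrite eA eqseq_cat // eqxx => /eqP[].
Qed.

(** Induction on the last step: if the height was already above h, the step is appended to [B];
    otherwise it must be a u leaving height exactly h, since no step rises by more than one. *)
Lemma last_passage w (h : int) : 0 <= h -> h < ht w ->
  exists A B, [/\ w = A ++ UStep :: B, ht A = h & stays 0 B].
Proof.
move=> h0; elim/last_ind: w => [|w s IH]; first by rewrite ht_nil; lia.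
rewrite -cats1 !htE addr0 => hs; have [lt|le] := ltrP h (ht w).
  have [A [B [ew hA hB]]] := IH lt; exists A, (B ++ [:: s]).
  split=> //; first by rewrite ew -catA.
  rewrite stays_cat hB /= add0r andbT.
  by move: hs; rewrite ew !htE hA /rise /=; have := stays_end hB; lia.
exists w, [::]; case: s hs; rewrite /rise /= => hs; split=> //; lia.
Qed.

Lemma trailing_V_uniq T q T' q' :
  T ++ nseq q VStep ++ [:: DStep] = T' ++ nseq q' VStep ++ [:: DStep] ->
  last DStep T != VStep -> last DStep T' != VStep -> T = T' /\ q = q'.
Proof.
rewrite !catA !cats1 => /rcons_inj[].
elim: q q' => [|q IH] [|q'].
- by rewrite !cats0.
- by rewrite cats0 => ->; rewrite last_cat -(rcons_nseq _ q') last_rcons eqxx.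
- rewrite -[nseq 0 _]/[::] cats0 => <- _.
  by rewrite last_cat -(rcons_nseq _ q) last_rcons eqxx.
- rewrite -!rcons_nseq -!rcons_cat => /rcons_inj[/IH h] h1 h2.
  by have [-> ->] := h h1 h2.
Qed.

(** * Evaluating psi on these shapes *)

Lemma returns_rcons w s : returns (rcons w s) =
  returns w ++ [seq (size w).+1 | _ <- nseq ((s == DStep) && (ht w + rise s == 0)) tt].
Proof.
rewrite /returns size_rcons -[X in iota 1 X]addn1 iotaD filter_cat /= add1n; congr (_ ++ _).
  apply/eq_in_filter => i; rewrite mem_iota add1n ltnS => /andP[i0 iw].
  rewrite !vertexE /= -cats1 nth_cat takel_cat //.
  by rewrite prednK // iw.
rewrite nth_rcons ltnn eqxx vertexE take_oversize ?size_rcons //= -cats1.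
by rewrite big_cat big_seq1 /= -/(ht w) -/(rise s); case: ifP.
Qed.

Lemma size_returns w : size (returns w) = nret 0 w.
Proof.
elim/last_ind: w => // w s IH.
rewrite returns_rcons size_cat size_map size_nseq IH -cats1 nret_cat /=.
by rewrite add0r addn0.
Qed.

(** A nonempty arch ends at its own last return, and the empty one is covered by index 0 for the
    zeroth return. *)
Lemma return_index_cat w1 w2 : arch w1 ->
  return_index (w1 ++ w2) (nret 0 w1)%:Z = size w1.
Proof.
move=> a1; rewrite /return_index absz_nat.
have [X eX] : exists X, returns (w1 ++ w2) = returns w1 ++ X.
  elim/last_ind: w2 => [|w2 s [X eX]]; first by exists [::]; rewrite !cats0.
  by rewrite -rcons_cat returns_rcons eX -catA; eexists.
rewrite eX -cat_cons nth_cat /= size_returns ltnSn -size_returns.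
rewrite -last_nth; case/archP: a1 => _ h0 _; case/lastP: w1 h0 {eX} => // w s.
rewrite last_rcons -cats1 !htE addr0 => h0 es.
by rewrite cats1 returns_rcons h0 es /= last_cat size_rcons.
Qed.

Lemma psi_step_up_form A B : arch A -> arch B ->
  psi_step (A ++ B) ((nret 0 (A ++ B))%:Z - 1) (nret 0 B, [:: 1]) = up_form A B.
Proof.
move=> aA aB; rewrite /psi_step /=.
have -> : (nret 0 (A ++ B))%:Z - 1 + 1 - (nret 0 B)%:Z = (nret 0 A)%:Z.
  by rewrite nret_cat_arch //; lia.
by rewrite return_index_cat // take_size_cat // drop_size_cat // /up_form.
Qed.

Definition down_split_label (ws : seq (seq ustep)) (T : seq ustep) : flabel :=
  (nret 0 T, [seq - (nret 0 w)%:Z | w <- ws]).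

Lemma sum_opp_nret ws :
  \sum_(b <- [seq - (nret 0 w)%:Z | w <- ws]) b = - (sumn (map (nret 0) ws))%:Z.
Proof.
elim: ws => [|w ws IH] /=; first by rewrite big_nil.
by rewrite big_cons IH; lia.
Qed.

Lemma nret_down_source A r ws T : down_split A r ws T ->
  nret 0 (down_source A r ws T) =
  (nret 0 (first_part A r) + sumn (map (nret 0) ws) + nret 0 T)%N.
Proof.
case/and5P => aA _ aws aT _; rewrite /down_source nret_cat_arch //.
by rewrite nret_cat_arch ?arch_flatten // nret_flatten // addnA.
Qed.

Lemma down_label_split A r ws T : down_split A r ws T ->
  down_label (down_split_label ws T).
Proof.
case/and5P => _ _ _ aT /andP[Tn wn]; rewrite /down_label /=.
rewrite (nret_arch_gt0 aT Tn) size_map lt0n size_eq0 wn /=.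
by apply/allP => _ /mapP[w _ ->]; rewrite oppr_le0.
Qed.

Lemma arch_down_source A r ws T : down_split A r ws T ->
  arch (down_source A r ws T).
Proof.
case/and5P => aA _ aws aT _.
by apply: arch_cat => //; apply: arch_cat => //; apply: arch_flatten.
Qed.

Lemma psi_step_down_form A r ws T : down_split A r ws T ->
  let S := down_source A r ws T in
  psi_step S ((nret 0 S)%:Z - 1) (down_split_label ws T) = down_form A r ws T.
Proof.
move=> ds S; have dl := down_label_split ds.
case/and5P: (ds) => aA lA aws aT /andP[Tn wn].
rewrite /psi_step; have -> : up_label (down_split_label ws T) = false.
  rewrite /up_label /=; case: (ws) wn => //= w ws' _.
  by rewrite eqseq_cons; apply/negP => /andP[]; lia.
rewrite /= size_map.
(* [W i] is the prefix ending at the return with index j_i. *)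
pose W i := first_part A r ++ flatten (take i ws).
have aW i : arch (W i).
  apply: arch_cat => //; apply: arch_flatten.
  by apply/allP => w /mem_take; move/allP: aws; apply.
have eS i : S = W i ++ flatten (drop i ws) ++ T.
  by rewrite /S /down_source /W -{1}(cat_take_drop i ws) flatten_cat !catA.
have ej i : return_index S ((nret 0 S)%:Z - 1 + 1 +
    \sum_(b <- drop i [seq - (nret 0 w)%:Z | w <- ws]) b - (nret 0 T)%:Z) = size (W i).
  rewrite -(@return_index_cat (W i) (flatten (drop i ws) ++ T)) // -eS.
  congr return_index; rewrite -map_drop sum_opp_nret nret_down_source //.
  rewrite /W nret_cat_arch // nret_flatten; last first.
    by apply/allP => w /mem_take; move/allP: aws; apply.
  by rewrite -{1}(cat_take_drop i ws) map_cat sumn_cat; lia.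
rewrite !ej.
have W0 : W 0%N = first_part A r by rewrite /W take0 cats0.
have An : A != [::].
  by have := ht_first_part aA; case: (A) => //; rewrite ht_nil; lia.
have sW0 : (size (W 0%N)).-1 = size (A ++ nseq r VStep).
  by rewrite W0 /first_part catA cats1 size_rcons.
have eS0 : S = (A ++ nseq r VStep) ++ DStep :: flatten ws ++ T.
  by rewrite /S /down_source /first_part -!catA.
have ep : ((size (W 0%N)).-1 -
    find (predC1 VStep) (rev (take (size (W 0%N)).-1 S)))%N = size A.
  rewrite sW0 eS0 take_size_cat // rev_cat rev_nseq find_cat has_nseq /= andbF.
  case/lastP: (A) An lA => // A' s _; rewrite last_rcons rev_rcons /= => ->.
  by rewrite size_nseq addn0 size_cat size_nseq addnK.
rewrite ep {1}eS0 -catA take_size_cat //.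
congr (_ ++ _).
congr (_ ++ _).
  rewrite /lifted -[in RHS](mkseq_nth [::] ws) /mkseq -map_comp.
  congr flatten; apply/eq_in_map => i; rewrite mem_iota add0n => iw /=.
  congr (_ :: _ ++ _); rewrite !ej /segment (eS i.+1) take_size_cat //.
  rewrite /W (take_nth [::] iw) flatten_rcons catA drop_size_cat //.
rewrite {1}(eS (size ws)) drop_size_cat // drop_size //=.
congr (_ ++ _); rewrite nseqD -catA; congr (_ ++ _).
by rewrite /segment (eS 0%N) take_size_cat // W0 drop_size_cat.
Qed.

(** Cutting [S] at the returns prescribed by the label reduces every valid step to [up_form] or
    [down_form]. *)
Lemma psi_step_cases S l : arch S -> S != [::] ->
  valid_label ((nret 0 S)%:Z - 1) l ->
  (exists A B, [/\ S = A ++ B, arch A, arch B & l = (nret 0 B, [:: 1])]) \/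
  (exists A r ws T, [/\ S = down_source A r ws T, down_split A r ws T &
                        l = down_split_label ws T]).
Proof.
move=> aS Sn /andP[hl hv].
have [hu|nu] := boolP (up_label l).
  left; case: l hl hv hu => a bs _ hv /eqP /= ebs; subst bs.
  rewrite /label_incr /= big_seq1 in hv.
  have [w1 [w2 [eS a1 a2 e1 e2]]] := arch_nret_split aS (leq_subr a (nret 0 S)).
  by exists w1, w2; split=> //; congr (_, _); move: hv e2; clear; lia.
right; case: l hl hv nu => a bs /orP[->//|/and3P[/= a1 bs1 hbs]] hv _.
have hsum := sumn_absz hbs.
(* These are the numbers of returns in sigma_1, ..., sigma_k and tau. *)
pose ns := rcons (map absz bs) a.
(* Since the new height is nonnegative, a return is left over to the left of sigma_1; its d ends
   beta. *)
have sns : (sumn ns < nret 0 S)%N.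
  move: hsum hv; rewrite /ns sumn_rcons /label_incr /=.
  by move: (\sum_(_ <- _) _) (sumn _) => s t; clear; lia.
have [W [R [eS aW aR eW eR]]] := arch_nret_split aS (leq_subr (sumn ns) (nret 0 S)).
have eR' : nret 0 R = sumn ns by move: sns eR; clear; lia.
have [wss [eR2 awss mwss]] := arch_nret_flatten aR eR'.
case/lastP: wss eR2 awss mwss => [|ws T] eR2.
  by move=> _ /(congr1 size); rewrite /ns size_rcons.
rewrite all_rcons map_rcons /ns => /andP[aT aws] /rcons_inj[ebs eT].
have Wn : W != [::].
  by apply: contraTneq sns => W0; move: eW; rewrite W0 /=; clear; lia.
case/lastP: W Wn aW eW eS => // w s _ aW eW eS.
have es : s = DStep by case/archP: aW => _ _ _; rewrite last_rcons.
have [A [r [ew hA]]] := trailing_V w.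
have eA : rcons w s = first_part A r by rewrite ew es -cats1 -catA.
exists A, r, ws, T; split.
- by rewrite eS eA eR2 flatten_rcons.
- apply/and5P; split=> //; first by rewrite -eA.
  apply/andP; split.
    by apply: contraTneq a1 => T0; rewrite -eT T0.
  by rewrite -size_eq0 -(size_map (nret 0)) ebs size_map size_eq0; case: (bs) bs1.
- rewrite /down_split_label eT; congr (_, _).
  have -> : [seq - (nret 0 w0)%:Z | w0 <- ws] = [seq - t%:Z | t <- map (nret 0) ws].
    by rewrite -map_comp.
  rewrite ebs -map_comp -[LHS]map_id; apply/eq_in_map => b bbs /=.
  by have := allP hbs _ bbs; lia.
Qed.

(** Exposes the run of v before the final d. It is empty here and nonempty in [down_form_tail],
    which tells the two cases of psi apart. *)
Lemma up_form_tail A B : arch B ->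
  last DStep (A ++ UStep :: B) != VStep /\
  up_form A B = (A ++ UStep :: B) ++ nseq 0 VStep ++ [:: DStep].
Proof.
case/archP => _ _ _ hB; split; last by rewrite -catA.
by rewrite last_cat /=; case: B hB => //= s w ->.
Qed.

Lemma down_form_tail A r ws T : down_split A r ws T ->
  last DStep (A ++ lifted ws ++ T) != VStep /\
  down_form A r ws T = (A ++ lifted ws ++ T) ++ nseq (size ws + r) VStep ++ [:: DStep].
Proof.
case/and5P => _ _ _ /archP[_ _ _ hT] /andP[Tn _]; split; last by rewrite -!catA.
by rewrite !last_cat; case: T hT Tn => //= s w ->.
Qed.

(* Peeling off the blocks [u sigma_i u] from the right by last passages; the
   process cannot go past alpha, since alpha does not end with u when r > 0. *)
Lemma lifted_inj A r ws A' r' ws' :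
  arch (first_part A r) -> arch (first_part A' r') ->
  last DStep A != VStep -> last DStep A' != VStep ->
  all arch ws -> all arch ws' -> (size ws + r = size ws' + r')%N ->
  A ++ lifted ws = A' ++ lifted ws' -> [/\ A = A', r = r' & ws = ws'].
Proof.
have aux X q Y q' vs v : arch (first_part X q) -> last DStep X != VStep ->
    (q = size (rcons vs v) + q')%N -> X <> Y ++ lifted (rcons vs v).
  move=> aX lX eq eX; have := last_first_part aX lX.
  by rewrite eq size_rcons eX lifted_rcons !last_cat /= last_cat => /(_ isT).
move=> aA aA' lA lA'; elim/last_ind: ws ws' => [|ws w IH] ws'; case/lastP: ws' => [|ws' w'].
- by rewrite !cats0 => _ _ ? ->.
- move=> _ _ /aux h; rewrite /= cats0 => /h; case=> //.
- by move=> _ _ /esym/aux h /esym; rewrite /= cats0 => /h; case.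
rewrite !all_rcons !size_rcons !lifted_rcons => /andP[/archP[s1 s2 _ _] aws].
case/andP => /archP[s1' s2' _ _] aws' esz.
have -> X V v : X ++ lifted V ++ UStep :: v ++ [:: UStep] =
    rcons ((X ++ lifted V) ++ UStep :: v) UStep by rewrite -cats1 -!catA.
rewrite -[A' ++ _](_ : rcons ((A' ++ lifted ws') ++ UStep :: w') UStep = _); last first.
  by rewrite -cats1 -!catA.
case/rcons_inj => /last_passage_uniq [].
- rewrite !htE !ht_lifted // (ht_first_part aA) (ht_first_part aA').
  by move: esz; clear; lia.
- by [].
- by [].
move=> eA ew; have [|-> -> ->] := IH ws' aws aws' _ eA; first by move: esz; clear; lia.
by rewrite ew.
Qed.

Lemma psi_step_inj S l S' l' : arch S -> arch S' -> S != [::] -> S' != [::] ->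
  valid_label ((nret 0 S)%:Z - 1) l -> valid_label ((nret 0 S')%:Z - 1) l' ->
  psi_step S ((nret 0 S)%:Z - 1) l = psi_step S' ((nret 0 S')%:Z - 1) l' ->
  S = S' /\ l = l'.
Proof.
move=> aS aS' Sn Sn' hv hv'.
have [[A [B [-> aA aB ->]]]|[A [r [ws [T [-> ds ->]]]]]] := psi_step_cases aS Sn hv;
have [[A' [B' [-> aA' aB' ->]]]|[A' [r' [ws' [T' [-> ds' ->]]]]]] :=
  psi_step_cases aS' Sn' hv'.
- rewrite !psi_step_up_form //.
  have [l1 ->] := up_form_tail A aB; have [l2 ->] := up_form_tail A' aB'.
  move=> /trailing_V_uniq/(_ l1 l2)[+ _].
  case/archP: aA aB => _ hA _ _ /archP[sB _ _ _].
  case/archP: aA' aB' => _ hA' _ _ /archP[sB' _ _ _].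
  by move=> /last_passage_uniq h; have [|//|//|-> ->] := h; rewrite ?hA ?hA'.
- rewrite psi_step_up_form // psi_step_down_form //.
  have [l1 ->] := up_form_tail A aB; have [l2 ->] := down_form_tail ds'.
  move=> /trailing_V_uniq/(_ l1 l2)[_]; case/and5P: ds' => _ _ _ _ /andP[_].
  by case: (ws').
- rewrite psi_step_up_form // psi_step_down_form //.
  have [l1 ->] := up_form_tail A' aB'; have [l2 ->] := down_form_tail ds.
  move=> /trailing_V_uniq/(_ l2 l1)[_]; case/and5P: ds => _ _ _ _ /andP[_].
  by case: (ws).
rewrite !psi_step_down_form //.
have [l1 ->] := down_form_tail ds; have [l2 ->] := down_form_tail ds'.
move=> /trailing_V_uniq/(_ l1 l2)[+ ek].
case/and5P: ds => aA lA aws /archP[sT _ _ _] /andP[Tn wn].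
case/and5P: ds' => aA' lA' aws' /archP[sT' _ _ _] /andP[Tn' wn'].
(* The last u of the lifted blocks leaves height 2(k + r), which is known from the final run of v.
   It is thus a last passage, and it cuts off tau. *)
have [X eX] : exists X, A ++ lifted ws = rcons X UStep.
  case/lastP: (ws) wn => // vs v _; exists (A ++ lifted vs ++ UStep :: v).
  by rewrite lifted_rcons -cats1 -!catA.
have [X' eX'] : exists X, A' ++ lifted ws' = rcons X UStep.
  case/lastP: (ws') wn' => // vs v _; exists (A' ++ lifted vs ++ UStep :: v).
  by rewrite lifted_rcons -cats1 -!catA.
rewrite !catA eX eX' !cat_rcons => /last_passage_uniq[] //.
  have := congr1 ht eX; have := congr1 ht eX'.
  rewrite -!cats1 !htE !ht_lifted // (ht_first_part aA) (ht_first_part aA').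
  by move: ek; clear; lia.
move=> eXX eT; have [|eA er ew] := lifted_inj aA aA' lA lA' aws aws' ek.
  by rewrite eX eX' eXX.
by rewrite eA er ew eT.
Qed.

(** * Undoing a step of psi *)

Lemma stays_take h w : stays h w <-> forall i, 0 <= h + ht (take i w).
Proof.
split=> [hw i|].
  by move: hw; rewrite -{1}(cat_take_drop i w) stays_cat => /andP[/stays_end].
elim: w h => [|s w IH] h hw; first by have := hw 0%N; rewrite ht_nil addr0 /= andbT.
rewrite /= IH; first by have := hw 0%N; rewrite ht_nil addr0 => ->.
by move=> i; have := hw i.+1; rewrite /= ht_cons addrA.
Qed.

Lemma UVD_arch n S : UVD n S <->
  [/\ S != [::], arch S & width S = (2 * n)%N%:Z].
Proof.
rewrite /UVD /= endpointE -/(ht S) -/(width S); split.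
  case=> -[e1 e2] hv huv hvu /suffixP[S' eS].
  split; first by rewrite eS; case: (S').
    apply/and4P; split.
    - by apply/stays_take => i; rewrite add0r; have := hv i; rewrite vertexE.
    - by rewrite e2.
    - by rewrite goodE huv.
    - by rewrite eS last_cat.
  by rewrite e1 PoszM.
case=> Sn /archP[s1 s2]; rewrite goodE => /andP[huv hvu] hl e1; split=> //.
- by rewrite e1 s2 PoszM.
- by move=> i; rewrite vertexE; have := (stays_take 0 S).1 s1 i; rewrite add0r.
- apply/suffixP; case/lastP: S hl Sn {s1 s2 huv hvu e1} => // S s.
  by rewrite last_rcons => -> _; exists S; rewrite cats1.
Qed.

(** The last passage at height 2q + 1 and the closing u delimit one block. The remainder has height
    2q + 1 and cannot end with v, as vu is forbidden. If it ends with d or q = 0, it is alpha with r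
    = q; if it ends with u, that u closes the next block and q decreases. *)
Lemma peel_lifted q X : stays 0 X -> good (X ++ [:: UStep]) ->
  ht X = (2 * q.+1)%N%:Z -> exists A r ws,
  [/\ X ++ [:: UStep] = A ++ lifted ws, last DStep A != VStep,
      (0 < r)%N -> last DStep A = DStep, ht A = (2 * r).+1%:Z &
      [/\ (size ws + r = q.+1)%N, all arch ws & ws != [::]]].
Proof.
elim: q X => [|q IH] X sX gX hX.
  have [||Y [w [eX hY sw]]] := @last_passage X 1; rewrite ?hX //.
  move: gX; rewrite eX -catA good_cat /= => /and3P[gY + cY].
  rewrite good_cons good_cat => /and3P[_ gw /andP[_ cw]].
  have hw : ht w = 0 by move: hX; rewrite eX !htE hY /rise /=; clear; lia.
  exists Y, 0%N, [:: w]; split=> //.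
  - by rewrite /lifted /= cats0.
  - by move: cY; case: (last _ _).
  - split=> //=; rewrite andbT; apply/and4P; split=> //; first by rewrite hw.
    by move: cw (stays_last sw hw); case: (last _ _).
have [||Y [w [eX hY sw]]] := @last_passage X (2 * q.+1).+1%:Z; rewrite ?hX //.
  by clear; lia.
have sY : stays 0 Y by move: sX; rewrite eX stays_cat => /andP[].
move: gX; rewrite eX -catA good_cat /= => /and3P[gY + cY].
rewrite good_cons good_cat => /and3P[_ gw /andP[_ cw]].
have hw : ht w = 0 by move: hX; rewrite eX !htE hY /rise /=; clear; lia.
have aw : arch w.
  apply/and4P; split=> //; first by rewrite hw.
  by move: cw (stays_last sw hw); case: (last _ _).
have lY : last DStep Y != VStep by move: cY; case: (last _ _).
have [lD|lD] := eqVneq (last DStep Y) DStep.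
  exists Y, q.+1, [:: w]; split=> //; first by rewrite /lifted /= cats0.
  by split=> //=; rewrite ?aw.
case/lastP: Y eX hY sY gY {cY} lY lD => // Y s eX hY sY gY.
rewrite last_rcons => lV lD; have es : s = UStep by case: (s) lV lD.
rewrite {}es -cats1 in eX hY sY gY *.
have [|||A [r [ws [eA lA lA' hA [eq aws wn]]]]] := IH Y.
- by move: sY; rewrite stays_cat => /andP[].
- by [].
- by move: hY; rewrite !htE /rise /=; clear; lia.
exists A, r, (rcons ws w); split=> //.
  by rewrite lifted_rcons catA -eA -!catA.
by split; rewrite ?size_rcons ?all_rcons ?aw -?eq //; case: (ws).
Qed.

Lemma psi_step_surj S : arch S -> S != [::] ->
  [\/ S = [:: UStep; DStep],
      exists A B, [/\ arch A, arch B, A ++ B != [::] & S = up_form A B] |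
      exists A r ws T, down_split A r ws T /\ S = down_form A r ws T].
Proof.
move=> aS; case/lastP: S aS => // S s aS _.
have es : s = DStep by case/archP: aS => _ _ _; rewrite last_rcons.
have [T [q [eS lT]]] := trailing_V S.
have eSr : rcons S s = T ++ nseq q VStep ++ [:: DStep] by rewrite es eS -cats1 -catA.
rewrite {}eSr {S s es eS} in aS *.
case/archP: (aS) => s1 s2 s3 _.
have hT : ht T = (2 * q).+1%:Z by move: s2; rewrite !htE /rise /=; clear; lia.
have sT : stays 0 T by move: s1; rewrite stays_cat => /andP[].
have /and3P[gT _ cT] : [&& good T, good (nseq q VStep ++ [:: DStep]) &
    compat (last DStep T) (head DStep (nseq q VStep ++ [:: DStep]))].
  by rewrite -good_cat.
(* This cuts off beta when q = 0 and tau when q > 0. *)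
have [||X [B [eT hX sB]]] := @last_passage T (2 * q)%N%:Z; rewrite ?hT //.
  by clear; lia.
have hB : ht B = 0 by move: hT; rewrite eT !htE hX /rise /=; clear; lia.
have lB : last DStep B = DStep.
  have := stays_last sB hB; move: lT; rewrite eT last_cat /=.
  by case: (B) => //= c w; case: (last c w).
have aB : arch B.
  move: gT; rewrite eT good_cat good_cons => /and3P[_ /andP[_ gB] _].
  by rewrite /arch sB hB gB lB.
case: q aS s1 s2 s3 hT cT hX => [|q] aS s1 s2 s3 hT cT hX.
  have aX : arch X.
    by move: aS; rewrite eT -catA => /arch_cat_split/(_ hX)[].
  case: (eqVneq (X ++ B) [::]) => [e|XB]; last first.
    by constructor 2; exists X, B; rewrite XB /up_form eT -catA.
  constructor 1; rewrite eT; case: (X) e => //= e.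
  by rewrite e.
have lTD : last DStep T = DStep by move: cT lT; case: (last _ _).
(* For q > 0 the word [T] is followed by v and so ends with d, while an empty [B] would leave a
   final u. A nonempty tau is what a >= 1 requires. *)
have Bn : B != [::].
  by apply: contra_eqN lTD => /eqP B0; rewrite eT B0 last_cat.
have [|||A [r [ws [eA lA lA' hA [eq aws wn]]]]] := @peel_lifted q X.
- by move: sT; rewrite eT stays_cat => /andP[].
- by move: gT; rewrite eT -cat_rcons -cats1 good_cat => /andP[].
- by [].
constructor 3; exists A, r, ws, B.
have eTA : T = A ++ lifted ws ++ B by rewrite eT -cat_rcons -cats1 eA catA.
split; last by rewrite /down_form eTA eq -!catA.
apply/and5P; split=> //; last by rewrite Bn.
have gA : good A by move: gT; rewrite eTA good_cat => /andP[].
have sA : stays 0 A by move: sT; rewrite eTA stays_cat => /andP[].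
apply/and4P; split.
- rewrite /first_part !stays_cat !htE sA hA stays_nseqV /= /rise /=.
  by clear; lia.
- by rewrite /first_part !htE hA /rise /=; clear; lia.
- rewrite /first_part good_cat gA good_nseqV /=.
  by case: r {eq hA} lA' => [|r] h; [case: (last _ _)|rewrite h].
- by rewrite /first_part !last_cat.
Qed.

Lemma psi_bij :
  (forall n, set_bij (LF n) (UVD n.+1) psi) /\
  (forall n Q, LF n Q -> (nret 0 (psi Q))%:Z - 1 = height Q).
Proof.
apply: (@bij_from_steps _ [:: UStep; DStep]
  (* The height argument of [psi_step] is replaced by the number of returns minus one, so that the
     step depends on the word and the label alone. *)
  (fun S l => psi_step S ((nret 0 S)%:Z - 1) l) psi UVD
  (fun S => (nret 0 S)%:Z - 1)) => //.
- by move=> Q l /= e; rewrite psi_rcons -e.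
- by apply/UVD_arch; split=> //; rewrite /arch ?width_cons ?htE // !widthE.
- move=> n S l _ /UVD_arch[Sn aS wS] hv.
  have [[A [B [eS aA aB el]]]|[A [r [ws [T [eS ds el]]]]]] := psi_step_cases aS Sn hv.
    rewrite {1}eS el eS psi_step_up_form // nret_up_form // nret_cat_arch //.
    split; last by rewrite /label_incr big_seq1 /=; clear; lia.
    apply/UVD_arch; split; first by rewrite /up_form; case: (A).
      exact: arch_up_form.
    by rewrite width_up_form -eS wS /=; clear; lia.
  rewrite el eS psi_step_down_form // nret_down_form // nret_down_source //.
  split; last first.
    rewrite /label_incr /= sum_opp_nret.
    by move: (sumn _) => s; clear; lia.
  apply/UVD_arch; split; first by rewrite /down_form; case: (A) (ws) ds => [|c A'] [|w ws'] // /and5P[_ _ _ _ /andP[]].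
    exact: arch_down_form.
  by rewrite width_down_form -eS wS /= size_map; clear; lia.
- move=> n S l n' S' l' _ _ /UVD_arch[Sn aS _] /UVD_arch[Sn' aS' _].
  exact: psi_step_inj.
- move=> n S n0 /UVD_arch[Sn aS wS].
  (* Semilength is half the width. A nonempty arch has positive width because it ends with d, so the
     shorter word still has semilength at least 1. *)
  have dim k w : width S = width w + (2 * k)%N%:Z -> w != [::] -> arch w ->
      [/\ (0 < n - k)%N, UVD (n - k) w & n = (n - k + k)%N].
    move=> e wn aw; have w1 : 1 <= width w.
      case/lastP: w wn aw {e} => // w s _ /archP[_ _ _]; rewrite last_rcons => ->.
      by rewrite -cats1 !widthE /=; have := width_ge0 w; clear; lia.
    have ww : width w = (2 * (n - k))%N%:Z.
      by move: w1 e; rewrite wS; clear; lia.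
    split; last by move: w1 e; rewrite wS; clear; lia.
      by move: w1; rewrite ww; clear; lia.
    by apply/UVD_arch.
  case: (psi_step_surj aS Sn) => [eS|[A [B [aA aB ABn eS]]]|[A [r [ws [T [ds eS]]]]]].
  + left; split=> //; move: wS; rewrite eS !widthE /=; clear; lia.
  + right; have [|h1 h2 h3] := @dim 1%N (A ++ B) _ ABn (arch_cat aA aB).
      by rewrite eS width_up_form.
    exists (n - 1)%N, (A ++ B), (nret 0 B, [:: 1]); split=> //.
      rewrite /valid_label /label_incr /= big_seq1 nret_cat_arch //; clear; lia.
    by rewrite psi_step_up_form.
  + right; have [||h1 h2 h3] := @dim (size ws) (down_source A r ws T) _ _ (arch_down_source ds).
    * by rewrite eS width_down_form.
    * by rewrite /down_source /first_part; case: (A) (r) => [|? ?] [|?].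
    exists (n - size ws)%N, (down_source A r ws T), (down_split_label ws T).
    split=> //; last by rewrite /= size_map.
      rewrite /valid_label (down_label_split ds) orbT /label_incr /= sum_opp_nret.
      have /and5P[aF _ _ _ _] := ds.
      rewrite nret_down_source // nret_first_part //.
      by move: (sumn _) => s; clear; lia.
    by rewrite psi_step_down_form.
Qed.

(** * The map M *)

Definition M_inv : seq ustep -> seq sstep :=
  map (fun s => match s with
                | UStep => NStep
                | VStep => EStep
                | DStep => HStep
                end).

Lemma M_K : cancel M M_inv.
Proof. by move=> P; rewrite /M /M_inv -map_comp map_id_in // => -[]. Qed.

Lemma M_invK : cancel M_inv M.
Proof. by move=> P; rewrite /M /M_inv -map_comp map_id_in // => -[]. Qed.

Lemma infix_M s P : infix (M s) (M P) = infix s P.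
Proof.
apply/infixP/infixP => -[a [b e]].
  exists (M_inv a), (M_inv b).
  by rewrite -[P]M_K e /M_inv !map_cat; congr (_ ++ (_ ++ _)); apply: M_K.
by exists (M a), (M b); rewrite e /M !map_cat.
Qed.

(** This is the linear map (x, y) -> (y, y - 2x), which turns the distance above y = 2x into the
    height above the axis. *)
Lemma vertex_M P i : vertex (map uvec (M P)) i =
  ((vertex (map svec P) i).2,
   (vertex (map svec P) i).2 - 2 * (vertex (map svec P) i).1).
Proof.
rewrite !vertexE -map_take !big_map /=; elim: (take i P) => [|s w IH].
  by rewrite !big_nil.
case: IH => IH1 IH2; rewrite !big_cons {}IH1 {}IH2.
move: (\sum_(t <- w) (svec t).1) (\sum_(t <- w) (svec t).2) => x y.
by case: s => /=; congr (_, _); clear; lia.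
Qed.

Lemma UVD_M n P : SP n P <-> UVD n (M P).
Proof.
rewrite /SP /UVD /schroder2 /= /endpoint !size_map vertex_M.
rewrite -[[:: UStep; VStep]]/(M [:: NStep; EStep]).
rewrite -[[:: VStep; UStep]]/(M [:: EStep; NStep]) !infix_M.
split.
  case=> -[ep hv] h1 h2 /suffixP[P' eP]; split=> //.
  - by rewrite ep /= subrr.
  - by move=> i; rewrite vertex_M subr_ge0.
  - by apply/suffixP; exists (M P'); rewrite eP /M map_cat.
case=> ep hv h1 h2 /suffixP[S' eS]; split=> //; first split.
- move: ep; case: (vertex _ _) => x y /= [-> /eqP]; rewrite subr_eq0.
  by move/eqP => e; congr (_, _); move: e; clear; lia.
- by move=> i; have := hv i; rewrite vertex_M subr_ge0.
- apply/suffixP; exists (M_inv S').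
  by rewrite -[P]M_K eS /M_inv map_cat.
Qed.

Lemma block_M P : block P = nret 0 (M P).
Proof.
rewrite -size_returns /returns size_filter size_map (iotaDl 1 0) count_map.
apply/eq_in_count => i; rewrite mem_iota add0n /= => iP.
rewrite vertex_M subr_eq0 /M (nth_map NStep) //.
by congr (_ && _); case: (nth _ _ _).
Qed.

Lemma M_bij n : set_bij (SP n) (UVD n) M.
Proof.
split; first by move=> P /UVD_M.
- by move=> P P' _ _; apply: can_inj M_K P P'.
- by move=> S hS; exists (M_inv S); rewrite ?M_invK //; apply/UVD_M; rewrite M_invK.
Qed.

Theorem mainTheorem1 (n : nat) (hn : (0 < n)%N) :
  [/\ set_fun (SP n) (UVD n) M,
      set_bij (LF n.-1) (UVD n) psi,
      set_bij (SP n) (IS102 n) (phi \o psi_inv n \o M)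
    & forall P : seq sstep, SP n P ->
        (block P)%:Z = rank ((phi \o psi_inv n \o M) P) + 1].
Proof.
have psib : set_bij (LF n.-1) (UVD n) psi.
  by have := psi_bij.1 n.-1; rewrite prednK.
have phib : set_bij (LF n.-1) (IS102 n) phi.
  by have := phi_bij.1 n.-1; rewrite prednK.
have [Mfun _ _] := M_bij n.
have invb : set_bij (UVD n) (LF n.-1) (psi_inv n) by apply: bijpinv_bij.
split=> //.
  exact: set_bij_comp (M_bij n) (set_bij_comp invb phib).
move=> P /Mfun uP; have [invf _ _] := invb.
have lfQ := invf _ uP.
have psiK : psi (psi_inv n (M P)) = M P.
  by case: psib => _ _ psis; rewrite /psi_inv (surjpK _ psis) // inE.
(* Both statistics are compared with the height of the intermediate labeled path: it is the rank on
   one side and the number of returns minus one on the other. *)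
rewrite /= (phi_bij.2 _ _ lfQ) -(psi_bij.2 _ _ lfQ) psiK block_M.
by rewrite subrK.
Qed.
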